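(* Consider the jump-diffusion model with noisy non-synchronous observations described in the context. Assume: (a) there exist positive constants $\nu_\mu,\nu_\gamma$ with $\max_{1\le i\le p}\sup_{0\le t\le 1}|\mu_i(t)|\le \nu_\mu$ a.s. and $\max_{1\le i\le p}\sup_{0\le t\le 1}\gamma_{ii}(t)\le\nu_\gamma$ a.s.; (b) the generalized sampling time $\{\tau_j\}$ is independent of the true log-price related processes and of the noises $\epsilon_i(t_{i,k})$, and $\max_{1\le j\le n}\Delta_j\le Cn^{-1}$ a.s.; (c) there exist positive constants $\nu_Q$ and $\alpha_1,\ldots,\alpha_p>1$ such that $\max_{1\le i\le p}\mathrm{E}\{|Q^c_{ii}(\tau_k)|^{\alpha_i}\}\le\nu_Q$ for all $1\le k\le n-K_n$; (d) for $i,j=1,\ldots,p$, $\mathrm{E}[\epsilon_i(t_{i,k})\epsilon_j(t_{j,k'})]=\eta_{ij}$ if $t_{i,k}=t_{j,k'}$, $\epsilon_i(t_{i,k})$ is independent of $\epsilon_j(t_{j,k'})$ if $t_{i,k}\ne t_{j,k'}$, and $\epsilon_i(\cdot)$ is independent of the true log-price related processes; (e) the Blumenthal-Getoor index satisfies $\pi\in[0,2)$, and $I_i(|x|>n^{(1-\alpha_i)/(4\alpha_i-2\alpha_i\pi)})<\infty$ (finite uniformly in $n$) for $i=1,\ldots,p$; (f) there exists a positive constant $\nu_{\rho,Q}$ such that $\max_{1\le i\le p}\mathrm{E}\{|Q^c_{\rho,ii}(\tau_k)|^{\alpha_i}\}\le\nu_{\rho,Q}$ for all $1\le k\le n-1$.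 Let $\delta^{-1}\in[n^{c},e^{n^{1/2}}]$ for some positive constant $c>0$, and let $\alpha_{ij}\in(1,2)$ for some $1\le i,j\le p$. Then, for a sufficiently large $n$, $$\min_{\hat\rho_{ij}(Q_{\rho,ij}(\tau_k),\delta)}\ \max_{Q^c_\rho\in\Xi_\rho(\alpha_1,\ldots,\alpha_p)}\Pr\left\{|\hat\rho_{ij}(Q_{\rho,ij}(\tau_k),\delta)-\rho_{ij}|\ge C\left(\log\delta^{-1}/n\right)^{(\alpha_{ij}-1)/\alpha_{ij}}\right\}\ge\delta,$$ where $$\Xi_\rho(\alpha_1,\ldots,\alpha_p)=\Big\{Q^c_\rho=(Q^c_{\rho,ii}(\tau_k))_{i=1,\ldots,p,\,k=1,\ldots,n-1}:\ \max_{i,k}\mathrm{E}\{|Q^c_{\rho,ii}(\tau_k)|^{\alpha_i}\}\le C\Big\}.$$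
   Context: $C$ denotes a generic positive constant whose value is free of $n$ and $p$ and may vary between appearances. Model. On a filtered probability space $(\Omega,\mathcal F,\{\mathcal F_t\}_{t\in[0,1]},P)$ satisfying the usual conditions, the true log-prices $X(t)=(X_1(t),\ldots,X_p(t))^\top$ satisfy $dX(t)=dX^c(t)+dJ(t)$, $dX^c(t)=\mu(t)dt+\sigma^\top(t)dW_t$, $X^c(0)=X(0)$, where $\mu(t)$ is a $p$-dimensional drift, $\sigma(t)$ is $q\times p$, and $W_t$ is a $q$-dimensional Brownian motion with independent components. The jump process is $J_i(t)=J_{i1}(t)+J_{i2}(t)$, with $J_{i1}(t)=\int_0^t\int_{|x|>1}x\,N_i(dx,ds)$ and $J_{i2}(t)=\int_0^t\int_{|x|\le1}x\,[N_i(dx,ds)-I_i(dx)ds]$, where $N_i$ is a Poisson random measure on $\mathbb R\times[0,1]$ with intensity measure $I_i(dx)ds$; $J_{i1}$ is a compound Poisson process with bounded intensity and $J_{i2}$ is an independent Lévy process. The Blumenthal-Getoor index is $\pi=\inf\{\delta\ge0:\int_{|x|\le1}|x|^\delta I_i(dx)<\infty\text{ for all }i=1,\ldots,p\}$. Put $\gamma(t)=(\gamma_{ij}(t))=\sigma^\top(t)\sigma(t)$. Observations. $Y_i(t_{i,k})=X_i(t_{i,k})+\epsilon_i(t_{i,k})$, $i=1,\ldots,p$, $k=0,\ldots,n_i$, where for each $i$ the noises $\epsilon_i(t_{i,k})$ are i.i.d. with mean zero; $\mathrm{E}[\epsilon_i(t)\epsilon_j(t)]=\eta_{ij}$, and $\epsilon_i(t)$,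 $\epsilon_j(t')$ are independent for $t\neq t'$. Sampling. A generalized sampling time is $0=\tau_0<\tau_1<\cdots<\tau_n=1$ such that each asset has at least one observation between consecutive $\tau_j$'s and $\Delta_j=\tau_j-\tau_{j-1}$ satisfy $\sup_j\Delta_j\to0$ in probability. For each $i,k$ choose any $\tau_{i,k}\in(\tau_{k-1},\tau_k]\cap\{t_{i,l}:l=0,\ldots,n_i\}$. Pre-averaging. $K_n=C_Kn^{1/2}$ for a constant $C_K>0$; $g$ is continuous and piecewise continuously differentiable with piecewise Lipschitz derivative, $g(0)=g(1)=0$, $\int_0^1g(t)^2dt>0$; $\phi=\frac1{K_n}\sum_{l=0}^{K_n-1}g(l/K_n)^2$; $\zeta=\sum_{l=0}^{K_n-1}\{g(l/K_n)-g((l+1)/K_n)\}^2$. With $Y^c_i(\tau_{i,k})=X^c_i(\tau_{i,k})+\epsilon_i(\tau_{i,k})$, put $Z^c_i(\tau_k)=\sum_{l=0}^{K_n-1}g(l/K_n)\{Y^c_i(\tau_{i,k+l+1})-Y^c_i(\tau_{i,k+l})\}$ and $Q^c_{ij}(\tau_k)=\frac{n-K_n}{\phi K_n}Z^c_i(\tau_k)Z^c_j(\tau_k)$ for $k=1,\ldots,n-K_n$. Also $Q_{\rho,ij}(\tau_k)=\frac12\{Y_i(\tau_{i,k+1})-Y_i(\tau_{i,k})\}\{Y_j(\tau_{j,k+1})-Y_j(\tau_{j,k})\}$ for $k=1,\ldots,n-1$, and $Q^c_{\rho,ij}(\tau_k)$ is the same with $Y$ replaced by $Y^c$. Target and estimators.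 $\rho_{ij}=\frac{\sum_{k=1}^n\mathbf 1(\tau_{i,k}=\tau_{j,k})}{\phi K_n}\zeta\eta_{ij}$ and $\alpha_{ij}=2\wedge\frac{2\alpha_i\alpha_j}{\alpha_i+\alpha_j}$. The minimum is over all estimators $\hat\rho_{ij}(Q_{\rho,ij}(\tau_k),\delta)=\hat\rho_{ij}(Q_{\rho,ij}(\tau_1),\ldots,Q_{\rho,ij}(\tau_{n-1}),\delta)$ of $\rho_{ij}$, i.e. functions of $Q_{\rho,ij}(\tau_1),\ldots,Q_{\rho,ij}(\tau_{n-1})$ and possibly of $\delta$. The maximum is over the data-generating models consisting of a jump-diffusion log-price process $dX(t)=\mu(t)dt+\sigma^\top(t)dW_t+dJ(t)$ observed with noise as $Y_i(t_{i,k})=X_i(t_{i,k})+\epsilon_i(t_{i,k})$ and sampled at the times $\tau_{i,k}$, whose variables $Q^c_{\rho,ii}(\tau_k)$ belong to $\Xi_\rho(\alpha_1,\ldots,\alpha_p)$; $\rho_{ij}$, the law of $Q_{\rho,ij}(\tau_k)$ and $\Pr$ are those of the model. *)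

(* Defs.v *)
From HB Require Import structures.
From mathcomp Require Export all_boot all_order all_algebra.
From mathcomp Require Export all_classical all_reals all_analysis.
From mathcomp Require Export measurable_realfun.

Set Implicit Arguments.
Unset Strict Implicit.
Unset Printing Implicit Defensive.

Export Order.TTheory GRing.Theory Num.Theory.
Export numFieldNormedType.Exports.

Local Open Scope classical_set_scope.
Local Open Scope ring_scope.

Section Probability.
Context {d : measure_display} {T : measurableType d} {R : realType}.
Variable P : probability T R.

(* [set_system I] is a filter on I: [\oo] for sequences, [0^'+] for a parameter
   decreasing to 0. *)
Definition cvg_in_prob (I : Type) (G : set_system I) (X : I -> T -> R)
    (Y : T -> R) : Prop :=
  forall e : R, 0 < e ->
    P [set w | e <= `|X m w - Y w|] @[m --> G] --> 0%E.

Definition events_of {d'} {S : measurableType d'} (X : T -> S) : set (set T) :=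
  preimage_set_system setT X measurable.

Definition indep_systems (G H : set (set T)) : Prop :=
  forall A B, G A -> H B -> P (A `&` B) = (P A * P B)%E.

Definition usual_filtration (F : R -> set (set T)) : Prop :=
  [/\ forall t, 0 <= t <= 1 ->
        sigma_algebra setT (F t) /\ F t `<=` @measurable _ T,
      forall s t, 0 <= s -> s <= t -> t <= 1 -> F s `<=` F t,
      forall t, 0 <= t < 1 -> \bigcap_(u in `]t, 1]) F u `<=` F t
    & forall A, P.-negligible A -> F 0 A].

Variable F : R -> set (set T).

Definition measurable_at (t : R) (X : T -> R) : Prop := events_of X `<=` F t.

Definition adapted (X : R -> T -> R) : Prop :=
  forall t, 0 <= t <= 1 -> measurable_at t (X t).

(* For every t in [0,1], (s, w) |-> H s w on [0,t] x T is measurable for the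
   product of the Borel sigma-algebra and F t. *)
Definition progressive (H : R -> T -> R) : Prop :=
  forall t, 0 <= t <= 1 -> forall V : set R, measurable V ->
    <<s [set C | exists (B : set R) (A : set T),
           [/\ measurable B, F t A & C = B `*` A] ] >>
      [set z : R * T | 0 <= z.1 <= t /\ V (H z.1 z.2)].

(* q-dimensional Brownian motion relative to the filtration, with independent
   components; [normal_prob m s] takes the standard deviation s. *)
Definition brownian (q : nat) (W : 'I_q -> R -> T -> R) : Prop :=
  [/\ forall m, adapted (W m),
      {ae P, forall w, forall m, W m 0 w = 0},
      {ae P, forall w, forall m, {within `[0, 1], continuous (W m ^~ w)} }
    & forall (s t : R) (A : set T) (B : 'I_q -> set R),
        0 <= s -> s < t -> t <= 1 -> F s A -> (forall m, measurable (B m)) ->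
        P (A `&` [set w | forall m, B m (W m t w - W m s w)]) =
        (P A * \prod_(m < q) normal_prob 0 (Num.sqrt (t - s)) (B m))%E].

(* The elementary integrand s |-> \sum_k coef k * 1_{lo k < s <= hi k}. *)
Record elementary := Elementary {
  esize : nat;
  lo : 'I_esize -> R;
  hi : 'I_esize -> R;
  coef : 'I_esize -> T -> R }.

Definition elementary_wf (E : elementary) : Prop :=
  forall k : 'I_(esize E),
    [/\ 0 <= lo k, lo k <= hi k, hi k <= 1, measurable_at (lo k) (coef k)
      & exists b : R, forall w, `|coef k w| <= b].

Definition elementary_fun (E : elementary) (s : R) (w : T) : R :=
  \sum_(k < esize E) (if lo k < s <= hi k then coef k w else 0).

Definition elementary_integral (W : R -> T -> R) (E : elementary)
    (t : R) (w : T) : R :=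
  \sum_(k < esize E)
    coef k w * (W (Num.min (hi k) t) w - W (Num.min (lo k) t) w).

(* M is (a continuous version of) the Ito integral \int_0^. H dW, obtained as
   the limit in probability of integrals of elementary integrands. *)
Definition is_ito_integral (H W M : R -> T -> R) : Prop :=
  [/\ progressive H, adapted M,
      {ae P, forall w, {within `[0, 1], continuous (M ^~ w)} }
    & exists E : nat -> elementary,
      [/\ forall m, elementary_wf (E m),
          forall e : R, 0 < e ->
            P [set w | (e%:E <= \int[lebesgue_measure]_(s in `[0%R, 1%R])
                 ((elementary_fun (E m) s w - H s w) ^+ 2)%:E)%E]
              @[m --> \oo] --> 0%E
        & forall t, 0 <= t <= 1 ->
            cvg_in_prob \oo (fun m => elementary_integral W (E m) t) (M t)] ].

(* Poisson random measure on R x [0,1], relative to the filtration, with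
   intensity L(dx) ds.  [poisson_prob r _ U] is the Poisson law with mean r,
   which is the Dirac mass at 0 when r = 0; its nat argument is a dummy. *)
Definition poisson_random_measure (L : {measure set R -> \bar R})
    (N : T -> {measure set (R * R) -> \bar R}) : Prop :=
  [/\ forall B : set (R * R), measurable B ->
        measurable_fun setT (fun w => N w B : \bar R),
      forall (t : R) (B : set (R * R)), 0 <= t <= 1 -> measurable B ->
        B `<=` [set z | 0 <= z.2 <= t] ->
        events_of (fun w => N w B : \bar R) `<=` F t,
      {ae P, forall w, N w [set z | z.2 = 0] = 0%E}
    & forall (s : R) (A : set T) (m : nat) (B : 'I_m -> set (R * R))
        (r : 'I_m -> R) (k : 'I_m -> nat),
        0 <= s <= 1 -> F s A ->
        (forall l, measurable (B l)) ->
        (forall l, B l `<=` [set z | s < z.2 <= 1]) ->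
        trivIset setT B ->
        (forall l, (L \x @lebesgue_measure R)%E (B l) = (r l)%:E) ->
        P (A `&` [set w | forall l, N w (B l) = (k l)%:R%:E]) =
        (P A * \prod_(l < m) poisson_prob (r l) 0 [set k l])%E].

Definition cadlag (f : R -> R) : Prop :=
  (forall t, 0 <= t < 1 -> f s @[s --> t^'+] --> f t) /\
  (forall t, 0 < t <= 1 -> cvg (f s @[s --> t^'-])).

(* \int_0^t \int_{|x|>1} x N(dx, ds) *)
Definition big_jumps (N : T -> {measure set (R * R) -> \bar R})
    (t : R) (w : T) : R :=
  \int[N w]_(z in [set z : R * R | 1 < `|z.1| /\ 0 < z.2 <= t]) z.1.

(* J is a cadlag version of \int_0^t \int_{|x|<=1} x [N(dx,ds) - L(dx)ds],
   the limit as e decreases to 0 of the compensated integrals over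
   e < |x| <= 1. *)
Definition is_small_jumps (L : {measure set R -> \bar R})
    (N : T -> {measure set (R * R) -> \bar R}) (J : R -> T -> R) : Prop :=
  [/\ adapted J, {ae P, forall w, cadlag (J ^~ w)}
    & forall t, 0 <= t <= 1 ->
      cvg_in_prob 0^'+ (fun (e : R) w =>
        \int[N w]_(z in [set z : R * R | e < `|z.1| <= 1 /\ 0 < z.2 <= t]) z.1
        - t * \int[L]_(x in [set x : R | e < `|x| <= 1]) x) (J t)].

End Probability.

Section Model.
Variables (R : realType) (p : nat).

(* A data-generating model with p assets.  Processes are indexed by times in
   [0,1]; [tobs i l] is relevant for l <= nobs i, [eps i t] for the observation
   times t of asset i and, with n sampling intervals, [tau k] for k <= n and
   [taui i k] for 1 <= k <= n. *)
Record model := Model {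
  disp : measure_display;
  Om : measurableType disp;
  Pr : probability Om R;
  filt : R -> set (set Om);
  q : nat;
  W : 'I_q -> R -> Om -> R;
  mu : 'I_p -> R -> Om -> R;
  sigma : 'I_q -> 'I_p -> R -> Om -> R;
  Xc : 'I_p -> R -> Om -> R;
  levy : 'I_p -> {measure set R -> \bar R};
  N : 'I_p -> Om -> {measure set (R * R) -> \bar R};
  J2 : 'I_p -> R -> Om -> R;
  nobs : 'I_p -> nat;
  tobs : 'I_p -> nat -> R;
  eps : 'I_p -> R -> Om -> R;
  eta : 'I_p -> 'I_p -> R;
  tau : nat -> Om -> R;
  taui : 'I_p -> nat -> Om -> R }.

Variables (M : model) (n : nat).

Definition gamma (i j : 'I_p) (t : R) (w : Om M) : R :=
  \sum_(m < q M) @sigma M m i t w * @sigma M m j t w.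

Definition X (i : 'I_p) (t : R) (w : Om M) : R :=
  @Xc M i t w + (big_jumps (@N M i) t w + @J2 M i t w).

Definition continuous_part : Prop :=
  [/\ forall i, measurable_at (@filt M) 0 (@Xc M i 0),
      forall i, progressive (@filt M) (@mu M i),
      {ae Pr M, forall w, forall i, lebesgue_measure.-integrable `[0, 1]
         (fun s : R => (@mu M i s w)%:E)}
    & exists I : 'I_(q M) -> 'I_p -> R -> Om M -> R,
      (forall m i, is_ito_integral (Pr M) (@filt M)
         (@sigma M m i) (@W M m) (I m i)) /\
      {ae Pr M, forall w, forall i t, 0 <= t <= 1 ->
         @Xc M i t w = @Xc M i 0 w
           + \int[lebesgue_measure]_(s in `[0, t]) @mu M i s w
           + \sum_(m < q M) I m i t w} ].

Definition levy_measure (L : {measure set R -> \bar R}) : Prop :=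
  [/\ L [set 0] = 0%E,
      (\int[L]_(x in [set x : R | (`|x| <= 1)%R]) (x ^+ 2)%:E < +oo)%E
    & (L [set x : R | (1 < `|x|)%R] < +oo)%E].

Definition jump_part : Prop :=
  forall i, [/\ levy_measure (@levy M i),
    poisson_random_measure (Pr M) (@filt M) (@levy M i) (@N M i)
    & is_small_jumps (Pr M) (@filt M) (@levy M i) (@N M i) (@J2 M i)].

Definition jump_diffusion : Prop :=
  [/\ usual_filtration (Pr M) (@filt M),
      brownian (Pr M) (@filt M) (@W M), continuous_part & jump_part].

Definition observation_times : Prop :=
  forall i, (forall l, (l <= @nobs M i)%N -> 0 <= @tobs M i l <= 1) /\
    (forall l, (l < @nobs M i)%N -> @tobs M i l < @tobs M i l.+1).

Definition noise_iid : Prop :=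
  forall i,
  [/\ forall l, (l <= @nobs M i)%N ->
        measurable_fun setT (@eps M i (@tobs M i l)),
      forall B : nat -> set R, (forall l, measurable (B l)) ->
        Pr M [set w | forall l, (l <= @nobs M i)%N ->
                        B l (@eps M i (@tobs M i l) w)] =
        (\prod_(l < (@nobs M i).+1)
           Pr M (@eps M i (@tobs M i l) @^-1` B l))%E,
      forall l (B : set R), (l <= @nobs M i)%N -> measurable B ->
        Pr M (@eps M i (@tobs M i l) @^-1` B) =
        Pr M (@eps M i (@tobs M i 0) @^-1` B)
    & forall l, (l <= @nobs M i)%N ->
        ('E_(Pr M)[@eps M i (@tobs M i l)] = 0)%E].

(* The existence of [taui i k] expresses that every asset is observed in
   (tau_{k-1}, tau_k]. *)
Definition sampling : Prop :=
  [/\ forall k, (k <= n)%N -> measurable_fun setT (@tau M k),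
      forall w, @tau M 0 w = 0 /\ @tau M n w = 1,
      forall k w, (k < n)%N -> @tau M k w < @tau M k.+1 w,
      forall i k, (0 < k <= n)%N -> measurable_fun setT (@taui M i k)
    & forall i k w, (0 < k <= n)%N ->
        @tau M k.-1 w < @taui M i k w <= @tau M k w /\
        exists2 l, (l <= @nobs M i)%N & @taui M i k w = @tobs M i l].

(* The true log-price related processes: X, X^c, the drift, the volatility, W
   and the jump measures (hence all jump components). *)
Definition price_events : set (set (Om M)) :=
  <<s [set A | exists (i : 'I_p) (t : R), 0 <= t <= 1 /\
         [\/ events_of (X i t) A, events_of (@Xc M i t) A,
             events_of (@mu M i t) A
           | exists m, events_of (@sigma M m i t) A] ]
   `|` [set A | exists (m : 'I_(q M)) (t : R), 0 <= t <= 1 /\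
         events_of (@W M m t) A]
   `|` [set A | exists (i : 'I_p) (B : set (R * R)),
         [/\ measurable B, B `<=` [set z | 0 <= z.2 <= 1]
           & events_of (fun w => @N M i w B : \bar R) A] ] >>.

Definition noise_events (i : 'I_p) : set (set (Om M)) :=
  <<s [set A | exists2 l, (l <= @nobs M i)%N &
                 events_of (@eps M i (@tobs M i l)) A] >>.

Definition sampling_events : set (set (Om M)) :=
  <<s [set A | exists2 k, (k <= n)%N & events_of (@tau M k) A]
   `|` [set A | exists (i : 'I_p) (k : nat), (0 < k <= n)%N /\
                  events_of (@taui M i k) A] >>.

Definition Y (i : 'I_p) (t : R) (w : Om M) : R := X i t w + @eps M i t w.
Definition Yc (i : 'I_p) (t : R) (w : Om M) : R := @Xc M i t w + @eps M i t w.

Definition Qrho (i j : 'I_p) (k : nat) (w : Om M) : R :=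
  2^-1 * (Y i (@taui M i k.+1 w) w - Y i (@taui M i k w) w)
       * (Y j (@taui M j k.+1 w) w - Y j (@taui M j k w) w).

Definition Qcrho (i j : 'I_p) (k : nat) (w : Om M) : R :=
  2^-1 * (Yc i (@taui M i k.+1 w) w - Yc i (@taui M i k w) w)
       * (Yc j (@taui M j k.+1 w) w - Yc j (@taui M j k w) w).

Variables (CK : R) (g : R -> R).

(* K_n = C_K n^{1/2} indexes sums, so its integer part is taken. *)
Definition Kn : nat := Num.truncn (CK * Num.sqrt n%:R).

Definition phi : R := Kn%:R^-1 * \sum_(0 <= l < Kn) g (l%:R / Kn%:R) ^+ 2.

Definition zeta : R :=
  \sum_(0 <= l < Kn) (g (l%:R / Kn%:R) - g (l.+1%:R / Kn%:R)) ^+ 2.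

Definition Zc (i : 'I_p) (k : nat) (w : Om M) : R :=
  \sum_(0 <= l < Kn) g (l%:R / Kn%:R) *
    (Yc i (@taui M i (k + l + 1)%N w) w - Yc i (@taui M i (k + l)%N w) w).

Definition Qc (i j : 'I_p) (k : nat) (w : Om M) : R :=
  (n%:R - Kn%:R) / (phi * Kn%:R) * Zc i k w * Zc j k w.

(* Random when the sampling times are. *)
Definition rho (i j : 'I_p) (w : Om M) : R :=
  (\sum_(1 <= k < n.+1) (@taui M i k w == @taui M j k w))%N%:R
    / (phi * Kn%:R) * zeta * @eta M i j.

Definition blumenthal_getoor : R :=
  inf [set e : R | 0 <= e /\ forall i,
    (\int[@levy M i]_(x in [set x : R | (`|x| <= 1)%R]) (`|x| `^ e)%:E
       < +oo)%E].

Definition cond_a (numu nugamma : R) : Prop :=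
  {ae Pr M, forall w, forall i t, 0 <= t <= 1 -> `|@mu M i t w| <= numu} /\
  {ae Pr M, forall w, forall i t, 0 <= t <= 1 -> gamma i i t w <= nugamma}.

Definition cond_b (CD : R) : Prop :=
  indep_systems (Pr M) sampling_events
    <<s price_events `|` \bigcup_i noise_events i >> /\
  {ae Pr M, forall w, forall k, (0 < k <= n)%N ->
     @tau M k w - @tau M k.-1 w <= CD / n%:R}.

Definition cond_c (alpha : 'I_p -> R) (nuQ : R) : Prop :=
  forall i k, (1 <= k <= n - Kn)%N ->
    ('E_(Pr M)[fun w => (`|Qc i i k w| `^ alpha i)%R] <= nuQ%:E)%E.

Definition cond_d : Prop :=
  (forall i j k k', (k <= @nobs M i)%N -> (k' <= @nobs M j)%N ->
     let ei := @eps M i (@tobs M i k) in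
     let ej := @eps M j (@tobs M j k') in
     (@tobs M i k = @tobs M j k' ->
        ('E_(Pr M)[fun w => (ei w * ej w)%R] = (@eta M i j)%:E)%E) /\
     (@tobs M i k <> @tobs M j k' ->
        indep_systems (Pr M) (events_of ei) (events_of ej))) /\
  (forall i, indep_systems (Pr M) (noise_events i) price_events).

Definition cond_e (alpha : 'I_p -> R) (nuI : R) : Prop :=
  0 <= blumenthal_getoor < 2 /\
  forall i, let u : R := n%:R `^
      ((1 - alpha i) / (4 * alpha i - 2 * alpha i * blumenthal_getoor)) in
    (@levy M i [set x : R | (u < `|x|)%R] <= nuI%:E)%E.

(* Used both for the moment hypothesis on Q^c_rho and for membership of
   Q^c_rho in the class Xi_rho, whose constants may differ. *)
Definition Qcrho_moments (alpha : 'I_p -> R) (b : R) : Prop :=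
  forall i k, (1 <= k <= n.-1)%N ->
    ('E_(Pr M)[fun w => (`|Qcrho i i k w| `^ alpha i)%R] <= b%:E)%E.

(* [Qrho_data i j w] lists Q_{rho,ij}(tau_k), k = 1, ..., n-1. *)
Definition Qrho_data (i j : 'I_p) (w : Om M) : n.-1.-tuple R :=
  [tuple Qrho i j k.+1 w | k < n.-1].

End Model.

Section Minimax.
Variable R : realType.

Definition derivable_lipschitz (g : R -> R) (u v : R) : Prop :=
  (forall x, u < x < v -> derivable g x 1) /\
  exists b : R, forall x y, u < x < v -> u < y < v ->
    `|derive1 g x - derive1 g y| <= b * `|x - y|.

(* Weight function: continuous on [0,1], and there is a finite partition
   0 = s_0 < s_1 < ... < s_m = 1 on whose open intervals g is differentiable
   with Lipschitz (hence continuous) derivative. *)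
Definition weight_function (g : R -> R) : Prop :=
  [/\ {within `[0, 1], continuous g},
      exists s : seq R, [/\ path <%R 0 s, last 0 s = 1
        & forall l, (l < size s)%N ->
            derivable_lipschitz g (nth 0 (0 :: s) l) (nth 0 s l)],
      g 0 = 0, g 1 = 0
    & (0 < \int[lebesgue_measure]_(t in `[0%R, 1%R]) (g t ^+ 2)%:E)%E].

(* [nuI] bounds the Levy tails uniformly in n; the other fields are the
   constants of the same name in the hypotheses. *)
Record bounds := Bounds {
  numu : R; nugamma : R; CDelta : R; nuQ : R; nuI : R; nurhoQ : R }.

(* 1 <= CDelta is forced by \sum_k (tau_k - tau_{k-1}) = 1. *)
Definition bounds_ok (b : bounds) : Prop :=
  [/\ 0 < numu b, 0 < nugamma b, 1 <= CDelta b
    & [/\ 0 < nuQ b, 0 < nuI b & 0 < nurhoQ b]].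

Definition admissible (p n : nat) (CK : R) (g : R -> R) (b : bounds)
    (alpha : 'I_p -> R) (M : model R p) : Prop :=
  [/\ jump_diffusion M, observation_times M, noise_iid M, sampling M n
    & [/\ cond_a M (numu b) (nugamma b),
          cond_b M n (CDelta b),
          cond_c M n CK g alpha (nuQ b),
          cond_d M
        & cond_e M n alpha (nuI b) /\ Qcrho_moments M n alpha (nurhoQ b)]].

Definition alpha_pair (a b : R) : R := Num.min 2 (2 * a * b / (a + b)).

Definition is_estimator (m : nat) (rhohat : m.-tuple R -> R -> R) : Prop :=
  forall delta, measurable_fun setT (rhohat ^~ delta).

Definition error_prob (p n : nat) (CK : R) (g : R -> R) (i j : 'I_p)
    (rhohat : n.-1.-tuple R -> R -> R) (delta r : R) (M : model R p)
    : \bar R :=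
  Pr M [set w | r <=
    `|rhohat (Qrho_data n i j w) delta - rho n CK g i j w|].

(* The minimum over estimators is the infimum and the maximum over admissible
   models with Q^c_rho in Xi_rho (with constant CXi) is the supremum. *)
Definition minimax_error (p n : nat) (CK : R) (g : R -> R) (b : bounds)
    (alpha : 'I_p -> R) (CXi : R) (i j : 'I_p) (delta r : R) : \bar R :=
  ereal_inf [set ereal_sup
      [set e | exists M : model R p,
         [/\ admissible n CK g b alpha M, Qcrho_moments M n alpha CXi
           & e = error_prob CK g i j rhohat delta r M] ]
    | rhohat in @is_estimator n.-1].

End Minimax.

(* Main.v *)
Require Import Defs.
From HB Require Import structures.
From mathcomp Require Import ring lra zify.
Set Implicit Arguments.
Unset Strict Implicit.
Unset Printing Implicit Defensive.
Local Open Scope classical_set_scope.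
Local Open Scope ring_scope.

(** The lower bound compares two models that differ only in the size of the
    noise.  In both there is no drift, no volatility and no jump; all assets
    are observed at the times k / n; and the noise of asset i at time k / n is
    [h i * (B_k - s)], where B_0, ..., B_n are independent Bernoulli variables
    with parameter [s = ln delta^-1 / (4 n)].  One model has [h = 0], hence
    [rho = 0] and vanishing data.  In the other one, [h i] and [h j] are as
    large as the moment conditions permit, [h i ^ (2 alpha_i) * s = kappa] for
    a small constant [kappa], and the other assets have no noise.  With the harmonic mean
    [a = 2 alpha_i alpha_j / (alpha_i + alpha_j)] the noise covariance is then
    [h i * h j * s * (1 - s) = kappa^(1/a) * s^((a-1)/a) * (1 - s)], which is
    of the order of the rate in the theorem.

    All data depend on differences of the B_k only, so they vanish whenever no
    B_k equals 1, an event of probability [(1 - s)^(n+1) >= delta]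
    ([quiet_prob_lower], [error_prob_quiet]).  On it the estimator returns the
    same number v in both models.  Since [rho] of the second model is at least
    twice the radius r of the error event, either [|v| >= r] or
    [|v - rho| >= r], and one of the two models has an error probability of at
    least delta.

    Two facts make this work.  First, [rho] is [eta] up to a constant factor:
    by telescoping and the Cauchy-Schwarz inequality the energy [zeta] of the
    increments of the weights is at least [phi / K_n] ([grid_energy_lower]),
    so the factor [n * zeta / (phi * K_n)] is at least [n / K_n^2]
    ([signal_factor]).  Second, the pre-averaged moments stay bounded: a
    summation by parts moves the differences from the noise to the Lipschitz
    weights, so [Z] is at most a multiple of [h / K_n] times the number of B_k
    equal to 1 in a window of K_n times ([spike_Qc_moment]).  As
    [delta^-1 <= exp (sqrt n)], the mean [K_n * s] of that number is bounded,
    and all its moments are at most a multiple of [K_n * s]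
    ([mean_heads_powR]).  This leaves [K_n^(1 - alpha) * h^(2 alpha) * s], up
    to a constant, for the moment of order alpha of [Q]. *)

(** * Weight functions on a uniform grid *)

Section Weights.
Variable R : realType.
Implicit Types (g : R -> R) (a : nat -> R) (K m : nat).

Definition lipschitz_between g (u v L : R) : Prop :=
  forall x y, u <= x -> x <= y -> y <= v -> `|g y - g x| <= L * (y - x).

(** A Lipschitz derivative is bounded, and the mean value theorem applies. *)
Lemma lipschitz_piece g (u v : R) : u < v ->
  {within `[u, v], continuous g} -> derivable_lipschitz g u v ->
  exists2 L, 0 <= L & lipschitz_between g u v L.
Proof.
move=> uv cg [dg [b gb]].
pose c := (u + v) / 2; have cin : u < c < v by rewrite /c; apply/andP; split; lra.
have b0 : 0 <= b.
  pose e := (c + v) / 2; have ein : u < e < v.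
    by move: cin => /andP[? ?]; rewrite /e; apply/andP; split; lra.
  have ce : 0 < `|c - e|.
    by rewrite normr_gt0 subr_eq0 lt_eqF// /e; move: cin => /andP[_ ?]; lra.
  by rewrite -(pmulr_lge0 _ ce) (le_trans _ (gb _ _ cin ein)).
exists (`|derive1 g c| + b * (v - u)).
  by rewrite addr_ge0// mulr_ge0// subr_ge0 ltW.
move=> x y ux; rewrite le_eqVlt => /orP[/eqP-> _|xy yv].
  by rewrite !subrr normr0 mulr0.
have [||z zxy ->] := @MVT R g (derive1 g) x y xy.
- move=> z; rewrite in_itv/= => /andP[xz zy].
  rewrite derive1E; apply: DeriveDef => //; apply: dg.
  by rewrite (le_lt_trans ux xz) (lt_le_trans zy yv).
- apply: continuous_subspaceW cg => z /=; rewrite !in_itv/= => /andP[xz zy].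
  by rewrite (le_trans ux xz) (le_trans zy yv).
rewrite normrM (ger0_norm (_ : 0 <= y - x)); last by rewrite subr_ge0 ltW.
apply: ler_wpM2r; first by rewrite subr_ge0 ltW.
move: zxy; rewrite in_itv/= => /andP[xz zy].
have zin : u < z < v by rewrite (le_lt_trans ux xz) (lt_le_trans zy yv).
rewrite -[X in `|X|](subrK (derive1 g c)) addrC (le_trans (ler_normD _ _))//.
rewrite lerD2l (le_trans (gb _ _ zin cin))// ler_wpM2l//.
move: zin cin => /andP[? ?] /andP[? ?].
by rewrite ler_norml; apply/andP; split; lra.
Qed.

Lemma lipschitz_glue g (u v w L1 L2 : R) : 0 <= L1 -> 0 <= L2 ->
  lipschitz_between g u v L1 -> lipschitz_between g v w L2 ->
  lipschitz_between g u w (L1 + L2).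
Proof.
move=> L10 L20 g1 g2 x y ux xy yw.
have [yv|/ltW vy] := leP y v.
  by rewrite (le_trans (g1 _ _ ux xy yv))// mulrDl lerDl mulr_ge0// subr_ge0.
have [vx|/ltW xv] := leP v x.
  by rewrite (le_trans (g2 _ _ vx xy yw))// mulrDl lerDr mulr_ge0// subr_ge0.
rewrite -(subrK (g v) (g y)) -addrA (le_trans (ler_normD _ _))//.
rewrite [leLHS]addrC mulrDl; apply: lerD.
  by rewrite (le_trans (g1 _ _ ux xv (lexx _)))// ler_wpM2l// lerD2r.
by rewrite (le_trans (g2 _ _ (lexx _) vy yw))// ler_wpM2l// lerD2l lerN2.
Qed.

Lemma lipschitz_partition g (s : seq R) (u : R) : path <%R u s ->
  {within `[u, last u s], continuous g} ->
  (forall l, (l < size s)%N -> derivable_lipschitz g (nth 0 (u :: s) l) (nth 0 s l)) ->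
  exists2 L, 0 <= L & lipschitz_between g u (last u s) L.
Proof.
elim: s u => [|v s IH] u /=.
  move=> _ _ _; exists 0 => // x y ux xy yu.
  by rewrite (le_anti (_ : x <= y <= x)) ?subrr ?normr0 ?mul0r// xy (le_trans yu ux).
move=> /andP[uv pvs] cg dg.
have vl : v <= last v s.
  elim: s v pvs {IH uv cg dg} => //= z s IH v /andP[vz /IH].
  exact: le_trans (ltW vz).
have [||L1 L10 g1] := @lipschitz_piece g u v uv.
- apply: continuous_subspaceW cg => z /=; rewrite !in_itv/= => /andP[->/=].
  by move=> /le_trans; exact.
- exact: (dg 0%N).
have [||L2 L20 g2] := IH v pvs.
- apply: continuous_subspaceW cg => z /=; rewrite !in_itv/= => /andP[vz ->].
  by rewrite (le_trans (ltW uv) vz).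
- by move=> l ls; exact: (dg l.+1).
by exists (L1 + L2); [exact: addr_ge0 | exact: lipschitz_glue g1 g2].
Qed.

Lemma weight_lipschitz g : weight_function g ->
  exists2 L, 0 < L & lipschitz_between g 0 1 L.
Proof.
move=> [cg [s [ps ls dg]] _ _ _].
have [|//|L L0 gL] := @lipschitz_partition g s 0 ps; first by rewrite ls.
rewrite ls in gL; exists (L + 1); first by rewrite ltr_pwDr.
move=> x y x0 xy y1; rewrite (le_trans (gL x y x0 xy y1))//.
by rewrite ler_wpM2r ?subr_ge0// lerDl.
Qed.

(** A sequence that starts at 0 and moves by at most d per step needs many
    steps to become large.  Telescoping the cubes makes this quantitative:
    each step changes [`|a| ^+ 3] by at most
    [3 / 2 * d * (a l ^+ 2 + a l.+1 ^+ 2)]. *)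
Lemma cube_le_sum_squares a (d : R) K m : 0 <= d -> a 0%N = 0 ->
  (forall l, (l < K)%N -> `|a l.+1 - a l| <= d) -> (m < K)%N ->
  `|a m| ^+ 3 <= 3 * d * \sum_(0 <= l < K) a l ^+ 2.
Proof.
move=> d0 a0 ad mK.
have step k : (k <= m)%N ->
    `|a k| ^+ 3 <= 3 / 2 * d * (2 * (\sum_(0 <= l < k) a l ^+ 2) + a k ^+ 2).
  elim: k => [|k IH] km; first by rewrite a0 normr0 big_geq// !expr0n/= !(mulr0, addr0).
  rewrite big_nat_recr//=; set S := \sum_(0 <= l < k) a l ^+ 2 in IH *.
  have {IH} := IH (ltnW km).
  have := ad k (leq_trans km (ltnW mK)).
  rewrite -(real_normK (num_real (a k))) -(real_normK (num_real (a k.+1))) => dk.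
  have : `|a k.+1| - `|a k| <= d := le_trans (lerB_dist _ _) dk.
  have : 0 <= `|a k| := normr_ge0 _; have : 0 <= `|a k.+1| := normr_ge0 _.
  move: `|a k| `|a k.+1| => p q q0 p0 pq IH.
  have : (q - p) * (q ^+ 2 + q * p + p ^+ 2) <= d * (3 / 2 * (p ^+ 2 + q ^+ 2)).
    apply: (@le_trans _ _ (d * (q ^+ 2 + q * p + p ^+ 2))).
      by rewrite ler_wpM2r// !addr_ge0// mulr_ge0.
    rewrite ler_wpM2l//; have := sqr_ge0 (q - p); nra.
  rewrite (_ : (q - p) * _ = q ^+ 3 - p ^+ 3); last by ring.
  lra.
apply: (le_trans (step _ (leqnn m))).
rewrite (big_cat_nat (leq0n m) (ltnW mK))/= [in leRHS](big_ltn mK).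
set S := \sum_(0 <= l < m) a l ^+ 2; set T := \sum_(m.+1 <= l < K) a l ^+ 2.
have T0 : 0 <= T by rewrite /T; apply: sumr_ge0 => i _; exact: sqr_ge0.
have := mulr_ge0 d0 T0; have := mulr_ge0 d0 (sqr_ge0 (a m)).
nra.
Qed.

(** The Cauchy-Schwarz inequality, obtained from the nonnegativity of the sum
    of the squares of [d l - S / K], where S is the sum on the left. *)
Lemma sqr_sum_le (d : nat -> R) K m : (m <= K)%N ->
  (\sum_(0 <= l < m) d l) ^+ 2 <= K%:R * \sum_(0 <= l < K) d l ^+ 2.
Proof.
move=> mK; case: K mK => [|K] mK.
  by move: mK; rewrite leqn0 => /eqP->; rewrite !big_geq// expr0n mul0r.
set S := \sum_(0 <= l < m) d l; set Q := \sum_(0 <= l < K.+1) d l ^+ 2.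
pose c := S / K.+1%:R.
have Qm : \sum_(0 <= l < m) d l ^+ 2 <= Q.
  rewrite /Q (big_cat_nat (leq0n m) mK)/= lerDl.
  by apply: sumr_ge0 => i _; exact: sqr_ge0.
have : 0 <= \sum_(0 <= l < m) (d l - c) ^+ 2.
  by apply: sumr_ge0 => i _; exact: sqr_ge0.
rewrite (_ : \sum_(0 <= l < m) (d l - c) ^+ 2 =
    \sum_(0 <= l < m) d l ^+ 2 - 2 * c * S + m%:R * c ^+ 2); last first.
  have -> : m%:R * c ^+ 2 = \sum_(0 <= l < m) c ^+ 2.
    by rewrite sumr_const_nat subn0 mulr_natl.
  rewrite /S mulr_sumr -sumrB.
  by rewrite -big_split; apply: eq_bigr => i _ /=; ring.
have mcK : m%:R * c ^+ 2 <= K.+1%:R * c ^+ 2.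
  by rewrite ler_wpM2r ?sqr_ge0// ler_nat.
move=> H; have : K.+1%:R * c ^+ 2 <= Q.
  have cS : K.+1%:R * c = S by rewrite /c mulrC divfK// pnatr_eq0.
  have : 2 * c * S = 2 * (K.+1%:R * c ^+ 2) by rewrite -cS; ring.
  lra.
move=> /(ler_wpM2l (ler0n R K.+1)); apply: le_trans.
by rewrite mulrA -expr2 -exprMn /c mulrC divfK// pnatr_eq0.
Qed.

Lemma summation_by_parts a (x : nat -> R) K :
  \sum_(0 <= l < K) a l * (x l.+1 - x l) =
  a K * x K - a 0%N * x 0%N - \sum_(0 <= l < K) (a l.+1 - a l) * x l.+1.
Proof.
elim: K => [|K IH]; first by rewrite !big_geq// subrr subr0.
by rewrite !big_nat_recr//= IH; ring.
Qed.

Lemma grid_lipschitz g (L : R) K l : lipschitz_between g 0 1 L -> (l < K)%N ->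
  `|g (l.+1%:R / K%:R) - g (l%:R / K%:R)| <= L / K%:R.
Proof.
move=> gL lK; have K0 : 0 < K%:R :> R by rewrite ltr0n (leq_ltn_trans _ lK).
apply: (le_trans (gL _ _ _ _ _)).
- by rewrite divr_ge0.
- by rewrite ler_pM2r ?invr_gt0// ler_nat.
- by rewrite ler_pdivrMr// mul1r ler_nat.
by rewrite -mulrBl -natrB// subSnn mul1r.
Qed.

Lemma weight_neq0 g : weight_function g -> exists2 x, 0 <= x < 1 & g x != 0.
Proof.
move=> [_ _ _ g1 gi]; apply: contrapT => g0.
suff : (\int[lebesgue_measure]_(t in `[0%R, 1%R]) (g t ^+ 2)%:E = 0)%E.
  by move=> gi0; rewrite gi0 ltxx in gi.
apply: integral0_eq => t /=; rewrite in_itv/= => /andP[t0 t1].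
suff -> : g t = 0 by rewrite expr0n.
move: t1; rewrite le_eqVlt => /orP[/eqP-> //|t1].
by apply: contrapT => /eqP gt; apply: g0; exists t; rewrite ?t0.
Qed.

(** The grid means of [g ^+ 2] stay away from 0: at a point x with [g x != 0],
    the value at the grid point below x is at least [`|g x| / 2] once the mesh
    is fine, and [cube_le_sum_squares] converts this value into a bound on the
    sum of squares. *)
Lemma grid_mean_lower g (L : R) : weight_function g -> 0 < L ->
  lipschitz_between g 0 1 L -> exists2 c, 0 < c & exists K0, forall K,
  (K0 <= K)%N -> c <= K%:R^-1 * \sum_(0 <= l < K) g (l%:R / K%:R) ^+ 2.
Proof.
move=> gw L0 gL; have [_ _ g0 _ _] := gw.
have [x /andP[x0 x1] gx] := weight_neq0 gw.
pose G := `|g x| / 2; have G0 : 0 < G by rewrite divr_gt0 ?normr_gt0.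
exists (G ^+ 3 / (3 * L)); first by apply: divr_gt0; [exact: exprn_gt0|exact: mulr_gt0].
exists (Num.truncn (L / G)).+1 => K LK.
have K0 : 0 < K%:R :> R by rewrite ltr0n (leq_ltn_trans _ LK).
have {}LK : L / K%:R <= G.
  rewrite ler_pdivrMr// mulrC -ler_pdivrMr// ltW//.
  by rewrite (lt_le_trans (truncnS_gt _))// ler_nat.
pose m := Num.truncn (x * K%:R).
have xK0 : 0 <= x * K%:R by rewrite mulr_ge0// ltW.
have /andP[mx xm] : m%:R <= x * K%:R < m.+1%:R := truncn_itv xK0.
have mK : (m < K)%N by rewrite -(ltr_nat R) (le_lt_trans mx)// gtr_pMl.
have Gm : G <= `|g (m%:R / K%:R)|.
  have : `|g x - g (m%:R / K%:R)| <= G.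
    apply: (le_trans _ LK); apply: (le_trans (gL _ _ _ _ (ltW x1))).
    - by rewrite divr_ge0.
    - by rewrite ler_pdivrMr.
    rewrite ler_wpM2l ?(ltW L0)// lerBlDr.
    rewrite -[X in X + _]mul1r -mulrDl addrC natr1.
    by rewrite ler_pdivlMr// ltW.
  have := lerB_dist (g x) (g (m%:R / K%:R)).
  by rewrite /G; lra.
have := @cube_le_sum_squares (fun l => g (l%:R / K%:R)) (L / K%:R) K m.
rewrite mul0r => /(_ (divr_ge0 (ltW L0) (ltW K0)) g0 _ mK) H.
rewrite ler_pdivrMr ?mulr_gt0//.
apply: (le_trans (_ : _ <= `|g (m%:R / K%:R)| ^+ 3)).
  by rewrite lerXn2r ?nnegrE// ltW.
apply: (le_trans (H _)); last by rewrite le_eqVlt; apply/orP; left; apply/eqP; ring.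
by move=> l lK; exact: grid_lipschitz.
Qed.

(** As g vanishes at 0, every grid value is a sum of increments, so
    [sqr_sum_le] bounds each term on the left. *)
Lemma grid_energy_lower g K : g 0 = 0 -> (0 < K)%N ->
  K%:R^-1 * \sum_(0 <= l < K) g (l%:R / K%:R) ^+ 2 <=
  K%:R * \sum_(0 <= l < K) (g (l%:R / K%:R) - g (l.+1%:R / K%:R)) ^+ 2.
Proof.
move=> g0 K0; have K0' : 0 < K%:R :> R by rewrite ltr0n.
rewrite mulrC ler_pdivrMr// [leRHS]mulr_natr.
set E := (X in _ <= X *+ _).
have -> : E *+ K = \sum_(0 <= l < K) E by rewrite sumr_const_nat subn0.
apply: ler_sum_nat => m /andP[_ mK].
have := @sqr_sum_le (fun l => g (l.+1%:R / K%:R) - g (l%:R / K%:R)) K m (ltnW mK).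
rewrite telescope_sumr// mul0r g0 subr0 => /le_trans; apply.
by under eq_bigr do rewrite -sqrrN opprB.
Qed.

End Weights.
(** * Independent Bernoulli variables on a finite space *)

(** Every subset is measurable, so this space is complete for any probability
    and the constant filtration of all subsets satisfies the usual
    conditions. *)
Definition flips (n : nat) : Type := {ffun 'I_n.+1 -> bool}.
HB.instance Definition _ n := Finite.on (flips n).
HB.instance Definition _ n := isPointed.Build (flips n) [ffun=> false].
HB.instance Definition _ n := @isMeasurable.Build default_measure_display
  (flips n) discrete_measurable discrete_measurable0
  discrete_measurableC discrete_measurableU.

Section Coins.
Variables (R : realType) (n : nat) (s : R).
Hypothesis s01 : 0 <= s <= 1.
Implicit Types (w : flips n) (f : flips n -> R) (A : set (flips n)).

Definition mass w : R := \prod_l bernoulli_pmf s (w l).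

Definition mean f : R := \sum_w mass w * f w.

Lemma mass_ge0 w : 0 <= mass w.
Proof. by apply: prodr_ge0 => l _; exact: bernoulli_pmf_ge0. Qed.

Definition atom (k : nat) : flips n := nth point (enum {: flips n}) k.

(** The product Bernoulli probability, written as a sum of weighted Dirac
    masses so that integrals against it are finite sums. *)
Definition coins : set (flips n) -> \bar R :=
  msum (fun k => mscale (NngNum (mass_ge0 (atom k))) \d_(atom k))
    (size (enum {: flips n})).

Lemma sum_atom (T : Type) (idx : T) (op : Monoid.com_law idx) (F : flips n -> T) :
  \big[op/idx]_(k < size (enum {: flips n})) F (atom k) = \big[op/idx]_w F w.
Proof. by rewrite -[RHS]big_enum (big_nth point) big_mkord. Qed.

(** Independence, as distributivity of products over sums. *)
Lemma mean_prod (F : 'I_n.+1 -> bool -> R) :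
  mean (fun w => \prod_l F l (w l)) = \prod_l (s * F l true + (1 - s) * F l false).
Proof.
transitivity (\prod_l \sum_b bernoulli_pmf s b * F l b).
  by rewrite bigA_distr_bigA; apply: eq_bigr => w _; rewrite -big_split.
by apply: eq_bigr => l _; rewrite big_bool.
Qed.

Lemma mean_cst (c : R) : mean (fun=> c) = c.
Proof.
rewrite /mean -mulr_suml; suff -> : \sum_w mass w = 1 by rewrite mul1r.
transitivity (mean (fun w => \prod_l (fun _ _ => 1) l (w l))).
  by apply: eq_bigr => w _; rewrite big1 ?mulr1.
by rewrite (mean_prod (fun _ _ => 1)) big1// => l _; rewrite !mulr1 addrC subrK.
Qed.

Lemma coinsE A : coins A = (mean (\1_A))%:E.
Proof.
rewrite /coins /msum (sum_atom _ (fun w => (mass w)%:E * \d_w A)%E).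
by rewrite /mean -sumEFin; apply: eq_bigr => w _; rewrite EFinM diracE indicE.
Qed.

HB.instance Definition _ := Measure.on coins.

Let coins_setT : coins setT = 1%E.
Proof. by rewrite coinsE indicT mean_cst. Qed.

HB.instance Definition _ := @Measure_isProbability.Build _ _ R coins coins_setT.

Lemma coins_set0 : coins set0 = 0%E.
Proof. exact: measure0. Qed.

Lemma ge0_integral_coins f : (forall w, 0 <= f w) ->
  (\int[coins]_w (f w)%:E = (mean f)%:E)%E.
Proof.
move=> f0; rewrite ge0_integral_measure_sum//; last by move=> w _; rewrite lee_fin.
rewrite /mean -sumEFin -[RHS]sum_atom; apply: eq_bigr => k _.
rewrite ge0_integral_mscale//; last by move=> w _; rewrite lee_fin.
by rewrite integral_dirac// diracT mul1e.
Qed.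

Lemma expectation_coins f : ('E_coins[f] = (mean f)%:E)%E.
Proof.
rewrite unlock integralE.
under eq_integral do rewrite funeposE -EFin_max.
rewrite ge0_integral_coins; last by move=> w; rewrite le_max lexx orbT.
under eq_integral do rewrite funenegE -EFinN -EFin_max.
rewrite ge0_integral_coins; last by move=> w; rewrite le_max lexx orbT.
rewrite -EFinB; congr _%:E; rewrite -sumrB; apply: eq_bigr => w _.
rewrite -mulrBr; congr (_ * _).
have [f0|f0] := leP 0 (f w); rewrite ?(max_l _ f0) ?(max_r (ltW f0)).
  by rewrite max_r ?subr0// oppr_le0.
by rewrite max_l ?opprK ?add0r// oppr_ge0 ltW.
Qed.

Lemma ler_mean f g : (forall w, f w <= g w) -> mean f <= mean g.
Proof. by move=> fg; apply: ler_sum => w _; rewrite ler_wpM2l ?mass_ge0. Qed.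

Lemma meanZ c f : mean (fun w => c * f w) = c * mean f.
Proof. by rewrite mulr_sumr; apply: eq_bigr => w _; rewrite mulrCA. Qed.

Lemma meanD f g : mean (fun w => f w + g w) = mean f + mean g.
Proof. by rewrite -big_split; apply: eq_bigr => w _; rewrite mulrDr. Qed.

Lemma mean_coord (k : 'I_n.+1) (F : bool -> R) :
  mean (fun w => F (w k)) = s * F true + (1 - s) * F false.
Proof.
have := mean_prod (fun l b => if l == k then F b else 1).
rewrite (bigD1 k)//= eqxx big1 ?mulr1; last first.
  by move=> l /negbTE ->; rewrite !mulr1 addrC subrK.
move=> <-; apply: eq_bigr => w _; congr (_ * _).
by rewrite (bigD1 k)//= eqxx big1 ?mulr1// => l /negbTE ->.
Qed.

Lemma coins_rectangle (B : 'I_n.+1 -> set bool) :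
  coins [set w | forall l, B l (w l)] = (\prod_l coins [set w : flips n | B l (w l)])%E.
Proof.
have indicB l (w : flips n) :
  \1_[set w : flips n | B l (w l)] w = (w l \in B l)%:R :> R.
  by rewrite indicE.
under eq_bigr => l _.
  rewrite coinsE (_ : mean _ = mean (fun w => (w l \in B l)%:R)).
    rewrite (mean_coord l (fun b => (b \in B l)%:R)); over.
  by apply: eq_bigr => w _; rewrite indicB.
rewrite coinsE prodEFin -(mean_prod (fun l b => (b \in B l)%:R)).
congr _%:E; apply: eq_bigr => w _; congr (_ * _); rewrite indicE.
have [wB|wB] := pselect (forall l, B l (w l)).
  by rewrite mem_set// big1// => l _; rewrite mem_set.
rewrite memNset//; move/existsNP : wB => [l wB].
by rewrite (bigD1 l)//= memNset// mul0r.
Qed.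

Lemma coins_coord (k : 'I_n.+1) (B : set bool) :
  coins [set w : flips n | B (w k)] =
  (s * (true \in B)%:R + (1 - s) * (false \in B)%:R)%:E.
Proof.
rewrite coinsE -(mean_coord k (fun b => (b \in B)%:R)).
by congr _%:E; apply: eq_bigr => w _; rewrite indicE.
Qed.

Lemma coins_indep2 (k k' : 'I_n.+1) (B B' : set bool) : k != k' ->
  coins ([set w : flips n | B (w k)] `&` [set w | B' (w k')]) =
  (coins [set w : flips n | B (w k)] * coins [set w : flips n | B' (w k')])%E.
Proof.
move=> kk'; pose C l := if l == k then B else if l == k' then B' else setT.
have -> : [set w : flips n | B (w k)] `&` [set w | B' (w k')] =
    [set w | forall l, C l (w l)].
  apply/seteqP; split=> w /=.
    move=> [Bk Bk'] l; rewrite /C.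
    by case: eqP => [->//|_]; case: eqP => [->|].
  move=> wC; have := wC k; have := wC k'.
  by rewrite /C eqxx eq_sym (negbTE kk') eqxx.
rewrite coins_rectangle (bigD1 k)//= (bigD1 k')/=; last by rewrite eq_sym.
rewrite big1 => [|l /andP[lk lk']]; rewrite /C.
  by rewrite eqxx [k' == k]eq_sym (negbTE kk') eqxx mule1.
by rewrite (negbTE lk) (negbTE lk'); exact: probability_setT.
Qed.

(** * Moments of the number of successes *)

Definition heads (S : {pred 'I_n.+1}) w : nat := (\sum_(j in S) w j)%N.

Lemma mean_pow2_heads (S : {pred 'I_n.+1}) :
  mean (fun w => 2 ^+ heads S w) = (1 + s) ^+ #|S|.
Proof.
pose F l (b : bool) : R := if l \in S then 2 ^+ b else 1.
transitivity (mean (fun w => \prod_l F l (w l))).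
  apply: eq_bigr => w _; congr (_ * _).
  by rewrite /heads /F -big_mkcond/= -prodrXr.
rewrite mean_prod -prodr_const [RHS]big_mkcond/=.
by apply: eq_bigr => l _; rewrite /F; case: ifP => _; rewrite ?expr0 ?expr1; ring.
Qed.

(** The factor [2 ^ N - 1] vanishes at [N = 0]; this is what makes the moments
    of a binomial variable of small mean proportional to that mean. *)
Lemma pow_le_pow2 (m N : nat) : (0 < m)%N ->
  (N ^ m <= 2 * m ^ m * (2 ^ N - 1))%N.
Proof.
move=> m0; case: N => [|N]; first by rewrite exp0n.
have le2 : (N.+1 ^ m <= m ^ m * 2 ^ N.+1)%N.
  have Nq : (N.+1 <= m * 2 ^ (N.+1 %/ m))%N.
    by rewrite (leq_trans (ltnW (ltn_ceil _ m0)))// mulnC leq_mul2l ltn_expl// orbT.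
  rewrite -(leq_exp2r _ _ m0) in Nq; rewrite (leq_trans Nq)// expnMn leq_mul2l -expnM.
  by rewrite leq_exp2l// leq_trunc_div orbT.
rewrite (leq_trans le2)// [leqRHS](_ : _ = m ^ m * (2 * (2 ^ N.+1 - 1)))%N; last first.
  by rewrite [(2 * m ^ m)%N]mulnC mulnA.
rewrite leq_mul2l mulnBr expnS.
have := expn_gt0 2 N; case: (2 ^ N)%N => // e _; apply/orP; right.
by rewrite -[X in (X <= _)%N]addn0 !mul2n -!addnn; lia.
Qed.

Lemma powR_le_pow2 (q : R) (m N : nat) : 0 < q -> q <= m%:R ->
  N%:R `^ q <= (2 * m ^ m)%:R * (2 ^+ N - 1).
Proof.
move=> q0 qm; have m0 : (0 < m)%N by rewrite -(ltr_nat R) (lt_le_trans q0).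
have -> : 2 ^+ N - 1 = (2 ^ N - 1)%:R :> R by rewrite natrB ?expn_gt0// natrX.
rewrite -natrM; have := pow_le_pow2 N m0; rewrite -(ler_nat R); apply: le_trans.
case: N => [|N]; first by rewrite powR0 ?gt_eqF// exp0n.
by rewrite natrX -powR_mulrn// ler_powR// ler1n.
Qed.

(** Every moment of a binomial variable is at most linear in its mean t as
    long as t is bounded: by [powR_le_pow2] it suffices to treat [2 ^ N - 1],
    whose mean is [(1 + s) ^+ #|S| - 1 <= expR t - 1 <= t * expR t]. *)
Lemma mean_heads_powR (S : {pred 'I_n.+1}) (q : R) (m : nat) :
  0 < q -> q <= m%:R ->
  mean (fun w => (heads S w)%:R `^ q) <=
  (2 * m ^ m)%:R * (#|S|%:R * s * expR (#|S|%:R * s)).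
Proof.
move=> q0 qm; apply: le_trans (_ : _ <= mean (fun w =>
  (2 * m ^ m)%:R * 2 ^+ heads S w + - ((2 * m ^ m)%:R * 1))) _.
  by apply: ler_mean => w; rewrite -mulrBr; exact: powR_le_pow2.
rewrite meanD mean_cst meanZ mean_pow2_heads -mulrBr ler_wpM2l//.
set t := _ * s; have s0 : 0 <= s by case/andP: s01.
apply: le_trans (_ : _ <= expR t - 1) _.
  rewrite lerD2r /t expRM_natl lerXn2r ?nnegrE ?expR_ge0 ?addr_ge0//.
  exact: expR_ge1Dx.
(* expR t - 1 <= t * expR t is 1 - t <= expR (- t) times expR t. *)
have := expR_ge1Dx (- t); rewrite expRN => H.
have e0 := expR_gt0 t; move: H.
rewrite -(ler_pM2l e0) mulfV ?gt_eqF// => H.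
lra.
Qed.

End Coins.

(** * Systems of trivial events *)

Section TrivialEvents.
Context {d : measure_display} {T : measurableType d} {R : realType}.
Variable P : probability T R.

Definition trivial_system (G : set (set T)) : Prop :=
  G `<=` [set A | A = set0 \/ A = setT].

Lemma events_of_cst d' (S : measurableType d') (X : T -> S) :
  (forall w w', X w = X w') -> trivial_system (events_of X).
Proof.
move=> Xc A [B _ <-]; rewrite setTI.
have [[w Bw]|B0] := pselect (exists w, B (X w)).
  by right; apply/seteqP; split=> // w' _; rewrite /preimage/= (Xc w' w).
by left; rewrite -subset0 => w Bw; apply: B0; exists w.
Qed.

Lemma trivial_sigma_algebra (G : set (set T)) :
  trivial_system G -> trivial_system <<s G >>.
Proof.
move=> G0; apply: smallest_sub => //; split=> /=.
- by left.
- by move=> A [->|->]; rewrite setTD; [right; rewrite setC0|left; rewrite setCT].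
- move=> F F0; have [[k Fk]|Fk] := pselect (exists k, F k = setT).
    by right; apply/seteqP; split=> // w _; exists k => //; rewrite Fk.
  left; rewrite bigcup0// => k _; have [//|FkT] := F0 k.
  by exfalso; apply: Fk; exists k.
Qed.

Lemma trivial_indepr (G H : set (set T)) :
  trivial_system H -> indep_systems P G H.
Proof.
move=> H0 A B _ /H0[->|->]; first by rewrite setI0 !measure0 mule0.
by rewrite setIT probability_setT mule1.
Qed.

Lemma trivial_indepl (G H : set (set T)) :
  trivial_system G -> indep_systems P G H.
Proof. by move=> G0 A B GA HB; rewrite setIC muleC; apply: (trivial_indepr G0). Qed.

End TrivialEvents.

(** * The pure noise model *)

Section SpikeModel.
Variables (R : realType) (p n : nat) (s : R).
Hypotheses (s01 : 0 <= s <= 1) (n_gt0 : (0 < n)%N).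
Variable h : 'I_p -> R.
Implicit Types (i j : 'I_p) (k l : nat) (w : flips n).

Definition tick k : R := k%:R / n%:R.

(** The noise is indexed by a time t; the coin that it uses is recovered as the
    integer part of [t * n], which is k at [t = tick k]. *)
Definition spike (i : 'I_p) (t : R) (w : flips n) : R :=
  h i * ((w (inord (Num.truncn (t * n%:R))))%:R - s).

Definition spike_model : model R p := {|
  disp := default_measure_display;
  Om := flips n;
  Pr := coins s01;
  filt := fun _ => setT;
  q := 0;
  W := fun _ _ _ => 0;
  mu := fun _ _ _ => 0;
  sigma := fun _ _ _ _ => 0;
  Xc := fun _ _ _ => 0;
  levy := fun _ => mzero;
  N := fun _ _ => mzero;
  J2 := fun _ _ _ => 0;
  nobs := fun _ => n;
  tobs := fun _ => tick;
  eps := spike;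
  Defs.eta := fun i j => h i * h j * (s * (1 - s));
  tau := fun k _ => tick k;
  taui := fun _ k _ => tick k |}.

Local Notation M := spike_model.

Lemma tick_lt : {mono tick : k l / (k < l)%N >-> k < l}.
Proof. by move=> k l; rewrite /tick ltr_pM2r ?invr_gt0 ?ltr0n// ltr_nat. Qed.

Lemma tick_inj : injective tick.
Proof.
move=> k l /eqP; rewrite eq_le !leNgt !tick_lt -!leqNgt => H.
by apply/eqP; rewrite eqn_leq.
Qed.

Lemma tick0 : tick 0 = 0. Proof. exact: mul0r. Qed.

Lemma tickn : tick n = 1.
Proof. by rewrite /tick divff// pnatr_eq0 -lt0n. Qed.

Lemma spike_tick i k w : spike i (tick k) w = h i * ((w (inord k))%:R - s).
Proof. by rewrite /spike /tick divfK ?natrK// pnatr_eq0 -lt0n. Qed.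

Lemma spike_jump_diffusion : jump_diffusion M.
Proof.
split.
- split=> //= t _; split=> //; exact: sigma_algebraT.
- split=> //=; try by apply: aeW => w [].
  move=> s' t A B _ _ _ _ _; rewrite big_ord0 mule1; congr (coins s01 _).
  by apply/seteqP; split=> w /=; [case|split=> // -[]].
- split=> //=.
  + move=> i t t01 V mV; have [V0|V0] := pselect (V 0).
      apply: sub_sigma_algebra; exists [set` `[0, t]], setT; split=> //.
      by apply/seteqP; split=> -[x w] /=; rewrite in_itv/= => -[].
    rewrite (_ : [set z : R * flips n | 0 <= z.1 <= t /\ V 0] = set0).
      exact: sigma_algebra0.
    by rewrite -subset0 => z [].
  + by apply: aeW => w i; exact: integrable0.
  + exists (fun _ _ _ _ => 0); split; first by case.
    by apply: aeW => w i t _; rewrite big_ord0 /Rintegral integral0_eq//= !addr0.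
- move=> i; split.
  + by split=> //=; rewrite ?integral_measure_zero ?ltry.
  + split=> //=; first by apply: aeW.
    move=> t A m B r k _ _ _ _ _ mB.
    have r0 (l : 'I_m) : r l = 0.
      have := mB l; rewrite /product_measure1 integral_measure_zero.
      by case.
    have kE (l : 'I_m) : poisson_prob (r l) 0 [set k l] = (k l == 0%N)%:R%:E.
      rewrite r0 /poisson_prob ltxx diracE; congr ((nat_of_bool _)%:R%:E).
      by apply/idP/eqP => [|->]; rewrite inE//= => ->.
    under eq_bigr do rewrite kE.
    have [/forallP k0|] := boolP [forall l, k l == 0%N].
      rewrite big1 ?mule1; last by move=> l _; rewrite k0.
      congr (coins s01 _); apply/seteqP; split=> w /=; first by case.
      by move=> Aw; split=> // l; rewrite (eqP (k0 l)).
    rewrite negb_forall => /existsP[l kl].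
    rewrite (bigD1 l)//= (negbTE kl) mul0e mule0 -(coins_set0 n s01).
    congr (coins s01 _); apply/seteqP; split=> w //= -[_ /(_ l)] /=.
    by case => /eqP; rewrite eq_sym pnatr_eq0 (negbTE kl).
  + split=> //=.
      apply: aeW => w; split=> t _ /=; [exact: cvg_cst|exact: is_cvg_cst].
    move=> t _ e e0; rewrite (_ : (fun _ => _) = cst 0%E); first exact: cvg_cst.
    apply/funext => x /=; rewrite -(coins_set0 n s01); congr (coins s01 _).
    apply/seteqP; split=> w //=.
    rewrite /Rintegral !integral_measure_zero /= mulr0 !subr0 normr0.
    by rewrite leNgt e0.
Qed.

Lemma spike_observation_times : observation_times M.
Proof.
move=> i; split=> /= l ln; last by rewrite tick_lt.
by rewrite /tick divr_ge0//= ler_pdivrMr ?ltr0n// mul1r ler_nat.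
Qed.

Lemma spike_noise_iid : noise_iid M.
Proof.
move=> i; split=> /=.
- by move=> l _ _ V _.
- move=> B _; have inordl (l : 'I_n.+1) : inord l = l := inord_val l.
  pose C (l : 'I_n.+1) := [set b : bool | B l (h i * (b%:R - s))].
  transitivity (coins s01 [set w : flips n | forall l : 'I_n.+1, C l (w l)]).
    congr (coins s01 _); apply/seteqP; split=> w /= wB.
      by move=> l; have := wB l (leq_ord l); rewrite spike_tick inordl.
    move=> l ln; have := wB (inord l).
    by rewrite spike_tick /C /= inordK.
  rewrite coins_rectangle; apply: eq_bigr => l _; congr (coins s01 _).
  by apply/seteqP; split=> w /=; rewrite /preimage/= spike_tick inordl.
- move=> l B ln _.
  have E k : spike i (tick k) @^-1` B =
      [set w : flips n | [set b : bool | B (h i * (b%:R - s))] (w (inord k))].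
    by apply/seteqP; split=> w /=; rewrite /preimage/= spike_tick.
  by rewrite !E !coins_coord.
- move=> l ln; rewrite expectation_coins; congr _%:E.
  under [mean _ _]eq_bigr do rewrite spike_tick.
  rewrite [LHS](mean_coord s (inord l) (fun b : bool => h i * (b%:R - s))).
  by rewrite /=; ring.
Qed.

Lemma spike_sampling : sampling M n.
Proof.
split=> //=.
- by rewrite tick0 tickn.
- by move=> k _ _; rewrite tick_lt.
- move=> i k _ /andP[k0 kn]; split; last by exists k.
  by rewrite lexx tick_lt prednK// leqnn.
Qed.

Lemma spike_cond_a (numu nugamma : R) :
  0 < numu -> 0 < nugamma -> cond_a M numu nugamma.
Proof.
move=> mu0 gamma0; split; apply: aeW => w i t _ /=; first by rewrite normr0 ltW.
by rewrite /gamma big_ord0 ltW.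
Qed.

Lemma spike_price_events : trivial_system (@price_events R p M).
Proof.
apply: trivial_sigma_algebra => A [[|]|] /=.
- move=> [i [t [_ []]]]; last by move=> [[]].
  + exact: events_of_cst.
  + exact: events_of_cst.
  + exact: events_of_cst.
- by move=> [[]].
- by move=> [i [B [_ _]]]; exact: events_of_cst.
Qed.

Lemma spike_cond_b (CD : R) : 1 <= CD -> cond_b M n CD.
Proof.
move=> CD1; split; last first.
  apply: aeW => w k /andP[k0 _] /=; rewrite /tick -mulrBl -natrB ?leq_pred//.
  by rewrite -subn1 subKn// ler_pM2r// invr_gt0 ltr0n.
apply: trivial_indepl; apply: trivial_sigma_algebra => A [|] /=.
  by move=> [k _]; exact: events_of_cst.
by move=> [i [k [_]]]; exact: events_of_cst.
Qed.

Lemma spike_cond_d : cond_d M.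
Proof.
split; last by move=> i; apply: trivial_indepr; exact: spike_price_events.
move=> i j k k' kn k'n /=; split.
  move=> /tick_inj <-; rewrite expectation_coins; congr _%:E.
  under [mean _ _]eq_bigr do rewrite !spike_tick.
  rewrite [LHS](mean_coord s (inord k)
    (fun b : bool => h i * (b%:R - s) * (h j * (b%:R - s)))).
  by rewrite /=; ring.
move=> kk' A A' [B _ <-] [B' _ <-]; rewrite !setTI.
have E i0 l0 C : spike i0 (tick l0) @^-1` C =
    [set w : flips n | [set b : bool | C (h i0 * (b%:R - s))] (w (inord l0))].
  by apply/seteqP; split=> w /=; rewrite /preimage/= spike_tick.
rewrite !E; apply: (@coins_indep2 _ _ _ s01 _ _ [set b : bool | B (h i * (b%:R - s))]
  [set b : bool | B' (h j * (b%:R - s))]).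
by apply/eqP => /(congr1 val); rewrite /= !inordK// => kE; apply: kk'; rewrite kE.
Qed.

Lemma spike_cond_e (alpha : 'I_p -> R) (nuI : R) : 0 < nuI -> cond_e M n alpha nuI.
Proof.
move=> nuI0; split; last by move=> i; rewrite /= lee_fin ltW.
rewrite /blumenthal_getoor; set S := [set e | _].
have S0 : S 0 by split=> // i; rewrite integral_measure_zero ltry.
have Slb : lbound S 0 by move=> e [].
apply/andP; split; first by apply: lb_le_inf => //; exists 0.
apply: (@le_lt_trans _ _ 0) => //; apply: ge_inf => //.
by exists 0.
Qed.

Lemma window_sum (k K : nat) (F : nat -> nat) : (k + K <= n)%N ->
  (\sum_(0 <= l < K) F (k + l).+1 = \sum_(j < n.+1 | k < j <= k + K) F j)%N.
Proof.
move=> kK; transitivity (\sum_(k.+1 <= j < (k + K).+1) F j)%N.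
  rewrite -{1}[k.+1]add0n big_addn subSS addKn.
  by apply: eq_bigr => l _; rewrite addnS addnC.
rewrite (@big_nat_widen _ _ _ k.+1 (k + K).+1 n.+1)// big_geq_mkord.
by apply: eq_bigl => j; rewrite ltnS andbC.
Qed.

Definition window (k K : nat) : {pred 'I_n.+1} := [pred j : 'I_n.+1 | k < j <= k + K]%N.

Lemma card_window k K : (k + K <= n)%N -> #|window k K| = K.
Proof.
move=> kK; rewrite -sum1_card -(window_sum (fun=> 1%N) kK).
by rewrite sum_nat_const_nat subn0 muln1.
Qed.

Lemma heads_window k K w : (k + K <= n)%N ->
  (\sum_(0 <= l < K) w (inord (k + l).+1) = heads (window k K) w)%N.
Proof.
move=> kK; rewrite (window_sum (fun l => w (inord l) : nat) kK).
by apply: eq_bigr => j _; rewrite inord_val.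
Qed.

Lemma Yc_spike i k w : Yc (M := M) i (tick k) w = h i * ((w (inord k))%:R - s).
Proof. by rewrite /Yc /= add0r spike_tick. Qed.

Lemma Y_spike i k w : Y (M := M) i (tick k) w = h i * ((w (inord k))%:R - s).
Proof.
rewrite /Y /X /= spike_tick /big_jumps /Rintegral integral_measure_zero.
by rewrite /= !addr0 add0r.
Qed.

(** A squared difference of two consecutive noises is 0 or [h i ^+ 2], and the
    latter requires one of two successes, which has probability at most
    [2 * s]. *)
Lemma spike_Qcrho_moments (alpha : 'I_p -> R) (b : R) :
  (forall i, 0 < alpha i) ->
  (forall i, 2 * ((h i ^+ 2) `^ alpha i * s) <= b) ->
  Qcrho_moments M n alpha b.
Proof.
move=> alpha0 hb i k _; rewrite expectation_coins lee_fin.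
apply: le_trans (hb i); set v := (h i ^+ 2) `^ alpha i.
pose u (e : bool) : R := v * e%:R.
apply: (le_trans (_ : _ <=
  mean s (fun w : flips n => u (w (inord k.+1)) + u (w (inord k))))); last first.
  rewrite meanD !(mean_coord s _ u) /u /=.
  by rewrite le_eqVlt; apply/orP; left; apply/eqP; ring.
apply: ler_mean => // w; rewrite /u -mulrDr /Qcrho /= !Yc_spike.
set e := (w _ : bool); set e' := (w (inord k)).
have [->|ee'] := eqVneq e e'.
  rewrite subrr !mulr0 normr0 powR0 ?gt_eqF//.
  by rewrite mulr_ge0 ?powR_ge0// addr_ge0.
have -> : e%:R + e'%:R = 1 :> R by case: e e' ee' => [] []; rewrite //= ?addr0 ?add0r.
rewrite mulr1 ge0_ler_powR ?nnegrE ?sqr_ge0//; first exact: ltW.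
have -> : h i * (e%:R - s) - h i * (e'%:R - s) = h i * (e%:R - e'%:R) by ring.
have e2 : (e%:R - e'%:R) ^+ 2 = 1 :> R.
  by case: e e' ee' => [] []; rewrite //= ?subr0 ?sub0r ?sqrrN expr1n.
rewrite -mulrA -expr2 exprMn e2 mulr1 normrM !ger0_norm ?sqr_ge0//.
by rewrite ler_piMl ?sqr_ge0// invf_le1// ler1n.
Qed.

(** After summation by parts, [Zc] is at most [`|h i| * (L / K)] times the
    number of successes in a window of length K, so by [mean_heads_powR] the
    moment is of order [(D / K) `^ a * (h i ^+ 2) `^ a * (K * s)], and
    [K `^ (1 - a) <= 1]. *)
Lemma spike_Qc_moment (CK : R) (g : R -> R) (L D B a : R) (m : nat) i k :
  g 0 = 0 -> g 1 = 0 -> 0 <= L -> lipschitz_between g 0 1 L -> 0 <= D ->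
  (0 < Kn n CK)%N ->
  n%:R / (phi n CK g * (Kn n CK)%:R) * (L / (Kn n CK)%:R) ^+ 2 <= D / (Kn n CK)%:R ->
  (Kn n CK)%:R * s <= B -> 1 < a -> 2 * a <= m%:R ->
  (1 <= k <= n - Kn n CK)%N ->
  ('E_(Pr M)[fun w => (`|Qc (M := M) n CK g i i k w| `^ a)%R] <=
   (D `^ a * (2 * m ^ m)%:R * expR B * ((h i ^+ 2) `^ a * s))%:E)%E.
Proof.
move=> g0 g1 L0 gL D0; set K := Kn n CK => K0 nD KsB a1 am /andP[k0 kn].
have kK : (k + K <= n)%N by rewrite addnC -leq_subRL// ltnW// -subn_gt0 (leq_trans k0).
have K0' : 0 < K%:R :> R by rewrite ltr0n.
have a0 : 0 < a by apply: lt_trans a1.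
have [s0 s1] := andP s01.
pose N (w : flips n) : R := (heads (window k K) w)%:R.
have Zle w : `|Zc (M := M) n CK g i k w| <= `|h i| * (L / K%:R) * N w.
  pose x l : R := h i * (w (inord (k + l)))%:R.
  have -> : Zc (M := M) n CK g i k w =
      \sum_(0 <= l < K) g (l%:R / K%:R) * (x l.+1 - x l).
    by apply: eq_bigr => l _; rewrite /= addn1 !Yc_spike /x addnS; ring.
  rewrite (summation_by_parts (fun l => g (l%:R / K%:R))) mul0r g0 divff ?gt_eqF// g1.
  rewrite !mul0r subrr sub0r normrN.
  apply: le_trans (ler_norm_sum _ _ _) _.
  rewrite /N -heads_window// natr_sum mulr_sumr big_nat_cond [leRHS]big_nat_cond.
  apply: ler_sum => l /andP[/andP[_ lK] _].
  rewrite normrM normrM [`|_%:R|]ger0_norm// addnS mulrA ler_wpM2r// mulrC.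
  by rewrite ler_wpM2l//; exact: grid_lipschitz.
pose A : R := n%:R / (phi n CK g * K%:R).
have phi0 : 0 <= phi n CK g.
  by rewrite /phi mulr_ge0 ?invr_ge0// sumr_ge0// => l _; exact: sqr_ge0.
have A0 : 0 <= A by rewrite divr_ge0// mulr_ge0// ltW.
have Qle w : `|Qc (M := M) n CK g i i k w| <= D / K%:R * (h i ^+ 2 * N w ^+ 2).
  rewrite /Qc -mulrA -expr2 normrM normrX.
  apply: (@le_trans _ _ (A * (`|h i| * (L / K%:R) * N w) ^+ 2)).
    apply: ler_pM => //; last by rewrite lerXn2r ?nnegrE// (le_trans _ (Zle w)).
    have nK : K%:R <= n%:R :> R by rewrite ler_nat (leq_trans _ kK)// leq_addl.
    rewrite ger0_norm; last by rewrite divr_ge0 ?subr_ge0// mulr_ge0// ltW.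
    rewrite ler_wpM2r ?gerBl//.
    by rewrite invr_ge0 mulr_ge0// ltW.
  rewrite !exprMn real_normK ?num_real//.
  rewrite [leLHS](_ : _ = A * (L / K%:R) ^+ 2 * (h i ^+ 2 * N w ^+ 2)).
    by rewrite ler_wpM2r// mulr_ge0 ?sqr_ge0.
  by rewrite exprMn; ring.
rewrite expectation_coins lee_fin.
pose c := (D / K%:R) `^ a * (h i ^+ 2) `^ a.
have c0 : 0 <= c by rewrite mulr_ge0 ?powR_ge0.
have DK0 : 0 <= D / K%:R by rewrite divr_ge0// ltW.
apply: (@le_trans _ _ (mean s (fun w => c * N w `^ (2 * a)))).
  apply: ler_mean => // w.
  apply: (le_trans (ge0_ler_powR (ltW a0) _ _ (Qle w))); rewrite ?nnegrE//.
    by rewrite mulr_ge0// mulr_ge0 ?sqr_ge0.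
  rewrite (powRM _ DK0); last by rewrite mulr_ge0 ?sqr_ge0.
  rewrite (powRM _ (sqr_ge0 (h i)) (sqr_ge0 (N w))) mulrA.
  by rewrite -[N w ^+ 2]powR_mulrn// -powRrM.
rewrite meanZ.
have a20 : 0 < 2 * a by rewrite mulr_gt0.
have := mean_heads_powR s01 (window k K) a20 am; rewrite card_window// => H.
apply: le_trans (ler_wpM2l c0 H) _.
have KV : (K%:R^-1) `^ a * K%:R <= 1 :> R.
  rewrite -powR_inv1 ?(ltW K0')// -powRrM mulN1r powRN mulrC ler_pdivrMr ?powR_gt0//.
  by rewrite mul1r -{1}[K%:R]powRr1 ?(ltW K0')// ler_powR ?ler1n// ltW.
have eB : expR (K%:R * s) <= expR B by rewrite ler_expR.
have KV0 : 0 <= K%:R^-1 :> R by rewrite invr_ge0 ltW.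
rewrite /c (powRM _ D0 KV0).
rewrite [leLHS](_ : _ = (D `^ a * (2 * m ^ m)%:R * ((h i ^+ 2) `^ a * s)) *
  (((K%:R^-1) `^ a * K%:R) * expR (K%:R * s))); last by ring.
rewrite [leRHS](_ : _ = (D `^ a * (2 * m ^ m)%:R * ((h i ^+ 2) `^ a * s)) *
  (1 * expR B)); last by ring.
apply: ler_wpM2l; first by rewrite !mulr_ge0 ?powR_ge0.
by apply: ler_pM => //; rewrite ?mulr_ge0 ?powR_ge0 ?expR_ge0// ltW.
Qed.

Lemma spike_admissible (CK : R) (g : R -> R) (b : bounds R) (alpha : 'I_p -> R) :
  bounds_ok b -> cond_c M n CK g alpha (nuQ b) -> Qcrho_moments M n alpha (nurhoQ b) ->
  admissible n CK g b alpha M.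
Proof.
move=> [numu0 nugamma0 CD1 [nuQ0 nuI0 nurho0]] cc cf.
split; [exact: spike_jump_diffusion|exact: spike_observation_times|
  exact: spike_noise_iid|exact: spike_sampling|split=> //].
- exact: spike_cond_a.
- exact: spike_cond_b.
- exact: spike_cond_d.
- by split=> //; exact: spike_cond_e.
Qed.

Lemma spike_rho (CK : R) (g : R -> R) i j w :
  rho (M := M) n CK g i j w = n%:R / (phi n CK g * (Kn n CK)%:R) * zeta n CK g *
    (h i * h j * (s * (1 - s))).
Proof.
by rewrite /rho /=; under eq_bigr do rewrite eqxx; rewrite sum_nat_const_nat subSS subn0 muln1.
Qed.

(** The centering by s cancels in the differences of the noise. *)
Lemma spike_data_quiet i j w : (forall k k' : 'I_n.+1, h i * (w k)%:R = h i * (w k')%:R) ->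
  Qrho_data (M := M) n i j w = [tuple 0 | k < n.-1].
Proof.
move=> hw; apply: eq_from_tnth => k; rewrite !tnth_mktuple /Qrho /= !Y_spike.
rewrite [X in 2^-1 * X * _](_ : _ = 0) ?mulr0 ?mul0r//.
by rewrite !mulrBr (hw (inord k.+2) (inord k.+1)) subrr.
Qed.

Lemma quiet_prob : coins s01 [set w : flips n | forall l : 'I_n.+1, w l = false] =
  ((1 - s) ^+ n.+1)%:E.
Proof.
rewrite (@coins_rectangle _ _ _ s01 (fun=> [set false])).
under eq_bigr => l _ do rewrite coins_coord.
rewrite prodEFin prodr_const card_ord memNset ?mem_set//=.
by rewrite mulr0 add0r mulr1.
Qed.

(** On the event without successes the estimator sees the zero vector. *)
Lemma error_prob_quiet (CK : R) (g : R -> R) i j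
    (rhohat : n.-1.-tuple R -> R -> R) (delta r : R) :
  (forall w, (forall l : 'I_n.+1, w l = false) -> r <=
    `|rhohat [tuple 0 | k < n.-1] delta - rho (M := M) n CK g i j w|) ->
  (((1 - s) ^+ n.+1)%:E <= error_prob CK g i j rhohat delta r M)%E.
Proof.
move=> H; rewrite -quiet_prob /error_prob.
apply: le_measure; rewrite ?inE//= => w w0.
by rewrite /= spike_data_quiet ?H// => k k'; rewrite !w0.
Qed.
End SpikeModel.

(** * Calibration of the rate *)

(** For [s <= 1/2] one has [1 - s >= exp (- 2 s)]. *)
Lemma quiet_prob_lower (R : realType) (n : nat) (s : R) : (0 < n)%N ->
  0 <= s -> s <= 2^-1 -> expR (- (4 * n%:R * s)) <= (1 - s) ^+ n.+1.
Proof.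
move=> n0 s0 s2.
have n1 : 1 <= n%:R :> R by rewrite ler1n.
apply: (@le_trans _ _ (expR (n.+1%:R * - (2 * s)))).
  by rewrite ler_expR -natr1; nra.
have s1 : 0 < 1 - s by lra.
rewrite expRM_natl lerXn2r ?nnegrE ?expR_ge0 ?(ltW s1)//.
rewrite expRN -[leRHS]invrK lef_pV2 ?posrE ?expR_gt0 ?invr_gt0//.
apply: le_trans (expR_ge1Dx _).
by rewrite -[leLHS]mul1r ler_pdivrMr//; nra.
Qed.

Section Rates.
Variable R : realType.

Lemma Kn_bounds (CK : R) (n K0 : nat) : 0 < CK ->
  2 + K0%:R <= CK * Num.sqrt n%:R ->
  [/\ (K0 <= Kn n CK)%N, (0 < Kn n CK)%N, (Kn n CK)%:R <= CK * Num.sqrt n%:R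
    & CK * Num.sqrt n%:R <= 2 * (Kn n CK)%:R].
Proof.
move=> CK0 big; have x0 : 0 <= CK * Num.sqrt n%:R by rewrite mulr_ge0 ?sqrtr_ge0// ltW.
have /andP[lo up] := truncn_itv x0; rewrite -/(Kn n CK) in lo up.
rewrite -natr1 in up; have K00 : 0 <= K0%:R :> R := ler0n _ _.
have K0K : (K0 <= Kn n CK)%N by rewrite -(ler_nat R); lra.
have K1 : (0 < Kn n CK)%N by rewrite -(ltr_nat R); lra.
split=> //; lra.
Qed.

(** The largest spike compatible with a moment of order a equal to kappa. *)
Lemma spike_size (a kappa s : R) : 0 < a -> 0 < kappa -> 0 < s ->
  (((kappa / s) `^ (2 * a)^-1) ^+ 2) `^ a * s = kappa.
Proof.
move=> a0 k0 s0; rewrite -powR_mulrn ?powR_ge0// -!powRrM.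
rewrite mulVf; last by rewrite gt_eqF// mulr_gt0.
by rewrite powRr1 ?divr_ge0 ?ltW// divfK// gt_eqF.
Qed.

(** The exponents [1 / (2 a1)] and [1 / (2 a2)] add up to the inverse of the
    harmonic mean of a1 and a2; this is the origin of the rate. *)
Lemma spike_covariance (a1 a2 kappa s : R) : 0 < a1 -> 0 < a2 -> 0 < kappa -> 0 < s ->
  let a := 2 * a1 * a2 / (a1 + a2) in
  (kappa / s) `^ (2 * a1)^-1 * (kappa / s) `^ (2 * a2)^-1 * s =
  kappa `^ a^-1 * s `^ ((a - 1) / a).
Proof.
move=> a10 a20 k0 s0 a; have ks0 : 0 < kappa / s by rewrite divr_gt0.
have E : (2 * a1)^-1 + (2 * a2)^-1 = a^-1.
  by rewrite /a; field; rewrite !gt_eqF ?addr_gt0.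
rewrite -powRD ?(gt_eqF ks0) ?implybT// E.
have a0 : 0 < a by rewrite /a divr_gt0 ?mulr_gt0 ?addr_gt0.
rewrite (_ : (a - 1) / a = 1 - a^-1); last by field; rewrite gt_eqF.
rewrite powRB ?(gt_eqF s0) ?implybT// powRr1 ?(ltW s0)//.
rewrite (powRM _ (ltW k0)) ?invr_ge0 ?(ltW s0)//.
rewrite -[s^-1]powR_inv1 ?(ltW s0)// -powRrM mulN1r powRN; ring.
Qed.

End Rates.
(** By [grid_energy_lower], [zeta >= phi / K_n], so phi cancels and
    [n / K_n ^ 2] remains. *)
Lemma signal_factor (R : realType) (CK : R) (g : R -> R) (n : nat) : 0 < CK -> (0 < n)%N ->
  g 0 = 0 -> (0 < Kn n CK)%N -> 0 < phi n CK g -> (Kn n CK)%:R <= CK * Num.sqrt n%:R ->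
  (CK ^+ 2)^-1 <= n%:R / (phi n CK g * (Kn n CK)%:R) * zeta n CK g.
Proof.
move=> CK0 n0 g0 K0 phi0 KCK.
have n0' : 0 < n%:R :> R by rewrite ltr0n.
have K0' : 0 < (Kn n CK)%:R :> R by rewrite ltr0n.
have K2 : (Kn n CK)%:R ^+ 2 <= CK ^+ 2 * n%:R.
  rewrite -[n%:R]sqr_sqrtr ?ler0n// -exprMn lerXn2r ?nnegrE//.
  by rewrite mulr_ge0 ?sqrtr_ge0// ltW.
have := grid_energy_lower g0 K0; rewrite -/(phi n CK g) -/(zeta n CK g) => pz.
apply: (@le_trans _ _ (n%:R / (Kn n CK)%:R ^+ 2)).
  rewrite ler_pdivlMr ?exprn_gt0// mulrC ler_pdivrMr ?exprn_gt0//.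
  by rewrite mulrC.
rewrite -mulrA [X in _ <= _ * X]mulrC ler_pM2l//.
have phiK0 := mulr_gt0 phi0 K0'; rewrite ler_pdivlMr//.
rewrite [leLHS](_ : _ = phi n CK g / (Kn n CK)%:R); last by field; rewrite gt_eqF.
by rewrite ler_pdivrMr// mulrC.
Qed.

Theorem theorem4 (R : realType) (CK : R) (g : R -> R) (b : bounds R)
    (CXi c a1 a2 : R)
    (CK_gt0 : 0 < CK) (gw : weight_function g) (bok : bounds_ok b)
    (CXi_gt0 : 0 < CXi) (c_gt0 : 0 < c) (a1_gt1 : 1 < a1) (a2_gt1 : 1 < a2)
    (a12 : 1 < alpha_pair a1 a2 < 2) :
  exists2 C : R, 0 < C &
  exists n0 : nat, forall (p : nat) (alpha : 'I_p -> R) (i j : 'I_p) (n : nat)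
    (delta : R),
    (forall l, 1 < alpha l) -> alpha i = a1 -> alpha j = a2 ->
    (n0 <= n)%N -> 0 < delta ->
    n%:R `^ c <= delta^-1 <= expR (Num.sqrt n%:R) ->
    (delta%:E <= @minimax_error R p n CK g b alpha CXi i j delta
       (C * (ln delta^-1 / n%:R) `^
              ((alpha_pair (alpha i) (alpha j) - 1)
                 / alpha_pair (alpha i) (alpha j))))%E.
Proof.
have [L L0 gL] := weight_lipschitz gw.
have [c0 c00 [K0 phiK]] := grid_mean_lower gw L0 gL.
have [_ _ g0 g1 _] := gw.
have [_ _ _ [nuQ0 _ nurho0]] := bok.
have a10 : 0 < a1 by apply: lt_trans a1_gt1.
have a20 : 0 < a2 by apply: lt_trans a2_gt1.
have alE : alpha_pair a1 a2 = 2 * a1 * a2 / (a1 + a2).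
  move: a12; rewrite /alpha_pair => /andP[_].
  by case: (leP 2 (2 * a1 * a2 / (a1 + a2))) => //; rewrite ltxx.
pose m := (Num.truncn (2 * (a1 + a2))).+1.
have am a : 0 <= a -> a <= a1 + a2 -> 2 * a <= m%:R.
  by move=> ? ?; have := truncnS_gt (2 * (a1 + a2)); rewrite -/m; lra.
(* D bounds n / (phi K_n) * L^2 / K_n: phi >= c0 and K_n >= CK sqrt n / 2. *)
pose D := 4 * L ^+ 2 / (CK ^+ 2 * c0).
have D0 : 0 <= D by rewrite divr_ge0 ?mulr_ge0 ?sqr_ge0// ltW.
(* The moment of order a of Q^c is at most G a * kappa; kappa is then chosen
   so that all moment constraints hold. *)
pose G a := D `^ a * (2 * m ^ m)%:R * expR (CK / 4).
have G0 a : 0 <= G a by rewrite !mulr_ge0 ?powR_ge0 ?expR_ge0.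
pose kappa := Num.min (Num.min (nurhoQ b) CXi / 2) (nuQ b / (1 + G a1 + G a2)).
have k0 : 0 < kappa.
  rewrite lt_min divr_gt0 ?lt_min ?nurho0//= divr_gt0//.
  by have := G0 a1; have := G0 a2; lra.
have k2 : 2 * kappa <= Num.min (nurhoQ b) CXi.
  by rewrite mulrC -ler_pdivlMr// ge_min lexx.
have Gk a : a = a1 \/ a = a2 -> G a * kappa <= nuQ b.
  move=> aE; have G12 : 0 < 1 + G a1 + G a2 by have := G0 a1; have := G0 a2; lra.
  have : kappa <= nuQ b / (1 + G a1 + G a2) by rewrite ge_min lexx orbT.
  rewrite ler_pdivlMr// mulrC; apply: le_trans; rewrite ler_pM2r//.
  by case: aE => ->; have := G0 a1; have := G0 a2; lra.
pose al := alpha_pair a1 a2; pose e := (al - 1) / al.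
(* 4^-1 `^ e comes from s = ln delta^-1 / (4 n); the last 4 makes room for
   1 - s >= 1/2 and for rho >= 2 r. *)
exists (kappa `^ al^-1 * 4^-1 `^ e / (4 * CK ^+ 2)).
  by rewrite divr_gt0 ?mulr_gt0 ?powR_gt0 ?exprn_gt0.
(* Large n gives 2 + K0 <= CK sqrt n, so that K_n >= K0 and
   K_n >= CK sqrt n / 2; n >= 2 makes ln delta^-1 positive. *)
exists (maxn 2 (Num.truncn (((2 + K0%:R) / CK) ^+ 2)).+1).
move=> p alpha i j n delta alpha1 ai aj; rewrite geq_max => /andP[n2 nK] d0.
rewrite ai aj -/al -/e => /andP[dlo dhi].
have n0 : (0 < n)%N by apply: leq_trans n2.
have n0' : 0 < n%:R :> R by rewrite ltr0n.
set Lam := ln delta^-1; have dV0 : 0 < delta^-1 by rewrite invr_gt0.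
have Lam0 : 0 < Lam.
  apply: (@lt_le_trans _ _ (ln (n%:R `^ c))); last by rewrite ler_ln ?posrE ?powR_gt0.
  by rewrite ln_powR mulr_gt0// ln_gt0// ltr1n.
have Lamn : Lam <= Num.sqrt n%:R by rewrite -(expRK (Num.sqrt _)) ler_ln ?posrE ?expR_gt0.
have sqn : Num.sqrt n%:R * Num.sqrt n%:R = n%:R :> R by rewrite -expr2 sqr_sqrtr.
have sqn1 : 1 <= Num.sqrt n%:R :> R by rewrite -{1}sqrtr1 ler_wsqrtr// ler1n.
pose s := Lam / (4 * n%:R).
have s0 : 0 < s by rewrite divr_gt0// mulr_gt0.
have s4 : s <= 4^-1.
  rewrite /s ler_pdivrMr ?mulr_gt0// mulrA mulVf ?pnatr_eq0// mul1r.
  by apply: (le_trans Lamn); rewrite -[leRHS]sqn ler_peMl// (le_trans _ sqn1).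
have s01 : 0 <= s <= 1 by apply/andP; split; lra.
have ds : delta <= (1 - s) ^+ n.+1.
  apply: le_trans (quiet_prob_lower n0 (ltW s0) _); last by lra.
  rewrite /s mulrC divfK ?gt_eqF ?mulr_gt0// expRN lnK ?posrE// invrK.
  exact: lexx.
have [K0K Kpos Khi Klo] : [/\ (K0 <= Kn n CK)%N, (0 < Kn n CK)%N,
    (Kn n CK)%:R <= CK * Num.sqrt n%:R & CK * Num.sqrt n%:R <= 2 * (Kn n CK)%:R].
  apply: Kn_bounds => //; rewrite mulrC -ler_pdivrMr//.
  have x0 : 0 <= (2 + K0%:R) / CK by rewrite divr_ge0 ?addr_ge0// ltW.
  rewrite -(ger0_norm x0) -sqrtr_sqr ler_wsqrtr// ltW//.
  by apply: lt_le_trans (truncnS_gt _) _; rewrite ler_nat.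
have K0' : 0 < (Kn n CK)%:R :> R by rewrite ltr0n.
have phi_lo : c0 <= phi n CK g by exact: phiK.
have phi0 : 0 < phi n CK g by exact: lt_le_trans phi_lo.
have Ks : (Kn n CK)%:R * s <= CK / 4.
  apply: (@le_trans _ _ (CK * Num.sqrt n%:R * s)); first by rewrite ler_pM2r.
  rewrite /s mulrA ler_pdivrMr ?mulr_gt0//.
  rewrite [leRHS](_ : _ = CK * (Num.sqrt n%:R * Num.sqrt n%:R)); last by rewrite sqn; field.
  by rewrite -mulrA ler_pM2l// ler_pM2l//; lra.
have nD : n%:R / (phi n CK g * (Kn n CK)%:R) * (L / (Kn n CK)%:R) ^+ 2 <=
    D / (Kn n CK)%:R.
  have nK2 : CK ^+ 2 * n%:R <= 4 * (Kn n CK)%:R ^+ 2.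
    rewrite -sqn -expr2 -exprMn (_ : 4 = 2 ^+ 2); last by rewrite -natrX.
    rewrite -exprMn lerXn2r ?nnegrE ?mulr_ge0 ?sqrtr_ge0//; exact: ltW.
  rewrite mulrAC -mulrA [leLHS](_ : _ = n%:R * L ^+ 2 / phi n CK g / (Kn n CK)%:R ^+ 2
    / (Kn n CK)%:R); last by field; rewrite !gt_eqF.
  rewrite ler_pM2r ?invr_gt0// ler_pdivrMr ?exprn_gt0// ler_pdivrMr//.
  rewrite [leRHS](_ : _ = L ^+ 2 * (4 * (Kn n CK)%:R ^+ 2) / CK ^+ 2 / c0 * phi n CK g);
    last by rewrite /D; field; rewrite !gt_eqF.
  apply: (@le_trans _ _ (L ^+ 2 * (CK ^+ 2 * n%:R) / CK ^+ 2 / c0 * c0)).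
    by rewrite le_eqVlt; apply/orP; left; apply/eqP; field; rewrite !gt_eqF.
  apply: ler_pM => //.
  - by rewrite !(mulr_ge0, invr_ge0, sqr_ge0)// ltW.
  - exact: ltW.
  - by rewrite !ler_pM2r ?invr_gt0 ?exprn_gt0// ler_pM2l// exprn_gt0.
have moments (h : 'I_p -> R) :
    (forall l, h l = 0 \/ (alpha l = a1 \/ alpha l = a2) /\
       (h l ^+ 2) `^ alpha l * s = kappa) ->
    admissible n CK g b alpha (spike_model n s01 h) /\
    Qcrho_moments (spike_model n s01 h) n alpha CXi.
  move=> hP; have a0 l : 0 < alpha l by exact: lt_trans (alpha1 l).
  have h2 l : 2 * ((h l ^+ 2) `^ alpha l * s) <= Num.min (nurhoQ b) CXi.
    case: (hP l) => [->|[_ ->//]].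
    by rewrite expr0n/= powR0 ?gt_eqF// mul0r mulr0 le_min !ltW.
  split; last first.
    by apply: spike_Qcrho_moments => // l; rewrite (le_trans (h2 l))// ge_min lexx orbT.
  apply: spike_admissible => //; last first.
    by apply: spike_Qcrho_moments => // l; rewrite (le_trans (h2 l))// ge_min lexx.
  move=> l k kn; have momentl := spike_Qc_moment s01 n0 h l g0 g1 (ltW L0) gL D0 Kpos
    nD Ks (alpha1 l).
  case: (hP l) => [h0|[aE hk]].
    apply: (le_trans (momentl _ _ (ltW (truncnS_gt _)) kn)).
    by rewrite lee_fin h0 expr0n/= powR0 ?gt_eqF// mul0r mulr0 ltW.
  apply: (le_trans (momentl m _ _ kn)).
    by apply: am; [exact: ltW|case: aE => ->; lra].
  by rewrite lee_fin hk; exact: Gk.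
apply: le_ereal_inf_tmp => _ [rhohat _ <-].
set r := kappa `^ _ * _ / _ * _.
have worst (h : 'I_p -> R) :
    admissible n CK g b alpha (spike_model n s01 h) /\
      Qcrho_moments (spike_model n s01 h) n alpha CXi ->
    r <= `|rhohat [tuple 0 | k < n.-1] delta -
      n%:R / (phi n CK g * (Kn n CK)%:R) * zeta n CK g *
        (h i * h j * (s * (1 - s)))| ->
    (delta%:E <= ereal_sup [set x | exists M : model R p,
      [/\ admissible n CK g b alpha M, Qcrho_moments M n alpha CXi
        & x = error_prob CK g i j rhohat delta r M] ])%E.
  move=> [hadm hXi] hr; apply: le_ereal_sup_tmp.
  exists (error_prob CK g i j rhohat delta r (spike_model n s01 h)).
    by exists (spike_model n s01 h).
  apply: (@le_trans _ _ ((1 - s) ^+ n.+1)%:E); first by rewrite lee_fin.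
  by apply: error_prob_quiet => // w _; rewrite spike_rho.
set v := rhohat _ _ in worst; have [rv|vr] := leP r `|v|.
  apply: (worst (fun=> 0)); first by apply: moments => l; left.
  by rewrite !mul0r mulr0 subr0.
(* Here |v| < r, so the model with spikes is the bad one for this estimator. *)
pose h l := if (l == i) || (l == j) then (kappa / s) `^ (2 * alpha l)^-1 else 0.
apply: (worst h).
  apply: moments => l; rewrite /h; case: ifP => [lij|_]; last by left.
  right; split; first by case/orP: lij => /eqP ->; [left|right].
  by apply: spike_size => //; exact: lt_trans (alpha1 l).
suff : 2 * r <= n%:R / (phi n CK g * (Kn n CK)%:R) * zeta n CK g *
    (h i * h j * (s * (1 - s))).
  set x := _ * zeta _ _ _ * _ => rx.
  have := lerB_dist x v; rewrite distrC; have := ler_norm x; lra.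
have := signal_factor CK_gt0 n0 g0 Kpos phi0 Khi.
set f := _ * zeta _ _ _ => fle.
have -> : h i * h j * (s * (1 - s)) = kappa `^ al^-1 * s `^ e * (1 - s).
  rewrite /h !eqxx orbT/= ai aj mulrA spike_covariance//.
  by rewrite /e /al alE.
have se : s `^ e = 4^-1 `^ e * (Lam / n%:R) `^ e.
  rewrite -powRM ?invr_ge0 ?divr_ge0 ?ltW//; congr (_ `^ _).
  by rewrite /s; field; rewrite gt_eqF.
have P0 : 0 <= kappa `^ al^-1 * s `^ e by rewrite mulr_ge0 ?powR_ge0.
apply: (@le_trans _ _ ((CK ^+ 2)^-1 * (kappa `^ al^-1 * s `^ e * 2^-1))).
  rewrite se /r le_eqVlt; apply/orP; left; apply/eqP; field.
  by rewrite gt_eqF.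
apply: ler_pM => //; first by rewrite invr_ge0 sqr_ge0.
  by rewrite mulr_ge0.
by rewrite ler_wpM2l//; lra.
Qed.
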